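(* Let $f:\mathbb{R}^n\to\mathbb{R}$ be twice continuously differentiable, let $\{x_k\}$ be generated by the MINRES-based linesearch method described in the context, and let $\mathcal A:=\{x^*:\liminf_{k\to\infty}\|x_k-x^*\|=0\}$ be the set of accumulation points of $\{x_k\}$. Suppose that: (1) $\nabla^2 f$ is locally Lipschitz continuous on a neighborhood $V_H$ of $\mathcal A$; (2) $B_k=\nabla^2 f(x_k)$ for all $k\in\mathbb{N}$; (3) $\zeta_k=\min\{\mathsf Z,z_k\|g_k\|^{\zeta}\}$ for all $k$, with $\mathsf Z>0$, $\zeta\in(0,1]$, $z_k\ge\bar z>0$; (4) $\sum_{k=1}^\infty a_k^{-1/\alpha}<\infty$ and $\sum_{k=1}^\infty z_k^{-1/\zeta}<\infty$. Suppose that $x^*\in\mathcal A$ is an accumulation point of $\{x_k\}$ at which $f$ satisfies the Kurdyka–Łojasiewicz property. Then either the method stops after finitely many iterations at a stationary point, or the whole sequence $\{x_k\}$ converges to $x^*$ with $\|g_k\|\to0$.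
   Context: Notation: $\|\cdot\|$ is the Euclidean norm for vectors and the spectral norm for matrices; $\mathbb S_n$ is the set of symmetric real $n\times n$ matrices; $g_k:=\nabla f(x_k)$. Kurdyka–Łojasiewicz (KL) property: for $\eta>0$, $\mathfrak L_\eta$ is the class of continuous concave functions $\varrho:[0,\eta)\to[0,\infty)$ with $\varrho\in C^1((0,\eta))$, $\varrho(0)=0$ and $\varrho'(t)>0$ for all $t\in(0,\eta)$. The function $f$ has the KL property at $\bar x$ if there exist $\eta\in(0,\infty]$, a neighborhood $V$ of $\bar x$ and $\varrho\in\mathfrak L_\eta$ such that $\varrho'(f(x)-f(\bar x))\,\|\nabla f(x)\|\ge1$ for all $x\in V$ with $0<f(x)-f(\bar x)<\eta$. MINRES routine (exact arithmetic). Given $A\in\mathbb S_n$, $b\in\mathbb{R}^n\setminus\{0\}$ and a tolerance $\theta\ge 0$, let $\mathcal K_t(A,b)=\mathrm{span}\{b,Ab,\dots,A^{t-1}b\}$, $p_0=0$, $p_t=\mathrm{argmin}_{p\in\mathcal K_t(A,b)}\|b-Ap\|$ and $r_t=b-Ap_t$. $\mathrm{MINRES}(A,b,\theta)$ performs, for $t=1,2,\dots$: (1) if $r_{t-1}^\top A r_{t-1}\le 0$ (non-positive curvature is detected), stop and return $d=\|b\|\, r_{t-1}/\|r_{t-1}\|$ with flag NPC; (2) otherwise compute $p_t$; if $\|r_t\|\le\theta\|b\|$, stop and return $d=p_t$ with flag SOL; otherwise continue with $t+1$. MINRES-based linesearch method. Input: $x_0\in\mathbb{R}^n$, $\rho,\sigma\in(0,1)$,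 $\alpha\in(0,1]$, $\mathsf A\in(0,1]$, $s>0$, tolerances $\theta_k\ge0$, parameters $a_k\ge\bar a>0$, and $\zeta_k\ge 0$. For $k=0,1,\dots$: set $g_k=\nabla f(x_k)$, choose $B_k\in\mathbb S_n$ (an approximation of $\nabla^2 f(x_k)$), and set $\bar B_k=B_k+\zeta_k I$. If $g_k=0$, stop. Otherwise compute $(d_k,\mathrm{flag}_k)$ by $\mathrm{MINRES}(\bar B_k,-g_k,\theta_k)$. If $\mathrm{flag}_k=\mathrm{SOL}$ and $d_k^\top\bar B_kd_k<\min\{\mathsf A,a_k\|g_k\|^{\alpha}\}\|d_k\|^2$, then reset $d_k=-g_k$ and $\mathrm{flag}_k=\mathrm{GD}$. Determine the step size $\lambda_k$ as follows and set $x_{k+1}=x_k+\lambda_kd_k$: - If $\mathrm{flag}_k\in\{\mathrm{SOL},\mathrm{GD}\}$: $\lambda_k=s\rho^j$ with $j\ge0$ the smallest integer such that $f(x_k+\lambda_kd_k)-f(x_k)\le\sigma\lambda_kd_k^\top g_k$. - If $\mathrm{flag}_k=\mathrm{NPC}$: consider the condition $(\ast)$ $f(x_k+\lambda d_k)-f(x_k)\le\sigma\lambda g_k^\top d_k+\frac{\sigma}{2}\lambda^2d_k^\top B_kd_k$. If $(\ast)$ fails for $\lambda=s$, then $\lambda_k=s\rho^j$ with $j$ the smallest positive integer such that $(\ast)$ holds for $\lambda = s\rho^j$. If $(\ast)$ holds for $\lambda=s$, then $\lambda_k=s\rho^{-j}$ with $j\ge0$ the largest integer such that $(\ast)$ holds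 for all $\lambda=s,s\rho^{-1},\dots,s\rho^{-j}$ (forward linesearch). Whenever the method is said to generate $\{x_k\}$, it is implicitly assumed that each forward linesearch stops after finitely many steps. *)

(* Defs.v *)
From HB Require Import structures.
From mathcomp Require Import all_boot all_order all_algebra.
From mathcomp Require Import all_classical all_reals all_analysis.

Set Implicit Arguments.
Unset Strict Implicit.
Unset Printing Implicit Defensive.

Import Order.TTheory GRing.Theory Num.Theory.
Import numFieldNormedType.Exports.

Local Open Scope classical_set_scope.
Local Open Scope ring_scope.

Section Euclidean.
Context {R : realType} {n : nat}.
Implicit Types (u v : 'cV[R]_n) (M : 'M[R]_n) (f : 'cV[R]_n -> R).

Definition dot u v : R := (u^T *m v) 0 0.

(* The norms provided by the library on matrix types are sup norms, which
   induce the same topology but are not the Euclidean and spectral norms. *)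
Definition enorm v : R := Num.sqrt (dot v v).

Definition specnorm M : R :=
  sup [set enorm (M *m u) | u in [set u | enorm u <= 1]].

Definition partial (i : 'I_n) f : 'cV[R]_n -> R :=
  fun x => 'D_(delta_mx i 0) f x.

Definition grad f (x : 'cV[R]_n) : 'cV[R]_n := \col_i partial i f x.

Definition hess f (x : 'cV[R]_n) : 'M[R]_n :=
  \matrix_(i, j) partial j (partial i f) x.

(* [differentiable] is Frechet differentiability, which makes the partial
   derivatives in [grad] and [hess] meaningful. *)
Definition twice_continuously_differentiable f : Prop :=
  [/\ forall x, differentiable f x,
      forall x, differentiable (grad f) x &
      continuous (hess f)].

Definition locally_lipschitz_on (V : set 'cV[R]_n) (H : 'cV[R]_n -> 'M[R]_n) :
    Prop :=
  forall x, V x -> exists2 U : set 'cV[R]_n, nbhs x U &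
    exists L : R, forall y z, (V `&` U) y -> (V `&` U) z ->
      specnorm (H y - H z) <= L * enorm (y - z).

(* The liminf is taken in the extended reals, so that it is +oo and not a
   default value when the distances diverge. *)
Definition accumulation_points (x : nat -> 'cV[R]_n) : set 'cV[R]_n :=
  [set y | limn_einf (fun k => (enorm (x k - y))%:E) = 0%E].

End Euclidean.

Section KurdykaLojasiewicz.
Context {R : realType} {n : nat}.

Definition desingularizing (eta : \bar R) (phi : R -> R) : Prop :=
  let D := [set t : R | 0 <= t /\ (t%:E < eta)%E] in
  [/\ {within D, continuous phi} /\ (forall t, D t -> 0 <= phi t),
      convex_function D (fun t => - phi t),
      forall t : R, 0 < t -> (t%:E < eta)%E ->
        derivable phi t 1 /\ {for t, continuous (derive1 phi)},
      phi 0 = 0 &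
      forall t : R, 0 < t -> (t%:E < eta)%E -> 0 < derive1 phi t].

Definition KL_property (f : 'cV[R]_n -> R) (xb : 'cV[R]_n) : Prop :=
  exists (eta : \bar R) (V : set 'cV[R]_n) (phi : R -> R),
    [/\ (0 < eta)%E, nbhs xb V, desingularizing eta phi &
      forall x, V x -> 0 < f x - f xb -> ((f x - f xb)%:E < eta)%E ->
        1 <= derive1 phi (f x - f xb) * enorm (grad f x)].

End KurdykaLojasiewicz.

Variant flag := SOL | NPC | GD.

Section Minres.
Context {R : realType} {n : nat}.
Variables (A : 'M[R]_n) (b : 'cV[R]_n) (theta : R).

Definition krylov (t : nat) : {vspace 'cV[R]_n} :=
  <<[seq A ^+ i *m b | i <- iota 0 t]>>%VS.

Definition krylov_argmin (t : nat) (p : 'cV[R]_n) : Prop :=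
  p \in krylov t /\
  forall q, q \in krylov t -> enorm (b - A *m p) <= enorm (b - A *m q).

(* [minres d fl]: the routine stops at some iteration t >= 1 and returns d
   with flag fl.  The iterates are given relationally: [p i] is any minimizer
   over the i-th Krylov space. *)
Definition minres (d : 'cV[R]_n) (fl : flag) : Prop :=
  exists (t : nat) (p : nat -> 'cV[R]_n),
    let r i := b - A *m p i in
    [/\ (0 < t)%N,
        p 0%N = 0 /\ (forall i, (0 < i <= t)%N -> krylov_argmin i (p i)),
        forall i, (0 < i < t)%N ->
          0 < dot (r i.-1) (A *m r i.-1) /\ theta * enorm b < enorm (r i) &
        [/\ dot (r t.-1) (A *m r t.-1) <= 0, fl = NPC &
            d = (enorm b / enorm (r t.-1)) *: r t.-1] \/
        [/\ 0 < dot (r t.-1) (A *m r t.-1), enorm (r t) <= theta * enorm b,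
            fl = SOL & d = p t]].

End Minres.

Section Method.
Context {R : realType} {n : nat}.
Variables (f : 'cV[R]_n -> R) (rho sigma alpha Acap s : R).

Definition armijo (x d : 'cV[R]_n) (l : R) : Prop :=
  f (x + l *: d) - f x <= sigma * l * dot d (grad f x).

Definition curvature_armijo (B : 'M[R]_n) (x d : 'cV[R]_n) (l : R) : Prop :=
  f (x + l *: d) - f x <=
    sigma * l * dot (grad f x) d + sigma / 2 * l ^+ 2 * dot d (B *m d).

Definition backtracking (x d : 'cV[R]_n) (l : R) : Prop :=
  exists j : nat, [/\ l = s * rho ^+ j, armijo x d l &
    forall i : nat, (i < j)%N -> ~ armijo x d (s * rho ^+ i)].

(* In the second alternative, the existence of the largest j is the standing
   assumption that the forward linesearch stops. *)
Definition curvature_linesearch (B : 'M[R]_n) (x d : 'cV[R]_n) (l : R) :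
    Prop :=
  let C := curvature_armijo B x d in
  (~ C s /\
   exists j : nat, [/\ (0 < j)%N, l = s * rho ^+ j, C l &
     forall i : nat, (0 < i < j)%N -> ~ C (s * rho ^+ i)]) \/
  (C s /\
   exists j : nat, [/\ l = s * rho ^- j,
     forall i : nat, (i <= j)%N -> C (s * rho ^- i) &
     forall j' : nat, (forall i : nat, (i <= j')%N -> C (s * rho ^- i)) ->
       (j' <= j)%N]).

Definition direction (theta a zeta : R) (B : 'M[R]_n) (x d : 'cV[R]_n)
    (fl : flag) : Prop :=
  let g := grad f x in
  let Bbar := B + zeta%:M in
  exists (d0 : 'cV[R]_n) (fl0 : flag),
    minres Bbar (- g) theta d0 fl0 /\
    let reset := fl0 = SOL /\
      dot d0 (Bbar *m d0) <
        Num.min Acap (a * enorm g `^ alpha) * enorm d0 ^+ 2 in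
    (reset /\ d = - g /\ fl = GD) \/ (~ reset /\ d = d0 /\ fl = fl0).

Definition step_size (B : 'M[R]_n) (x d : 'cV[R]_n) (fl : flag) (l : R) :
    Prop :=
  match fl with
  | SOL | GD => backtracking x d l
  | NPC => curvature_linesearch B x d l
  end.

Definition iteration (theta a zeta : R) (B : 'M[R]_n) (x x' : 'cV[R]_n) :
    Prop :=
  exists (d : 'cV[R]_n) (fl : flag) (l : R),
    [/\ direction theta a zeta B x d fl, step_size B x d fl l &
        x' = x + l *: d].

(* A run which stops is encoded by repeating its last iterate forever. *)
Definition generated (theta a zeta : nat -> R) (B : nat -> 'M[R]_n)
    (x : nat -> 'cV[R]_n) : Prop :=
  forall k, (B k)^T = B k /\
    (grad f (x k) = 0 -> x k.+1 = x k) /\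
    (grad f (x k) <> 0 ->
       iteration (theta k) (a k) (zeta k) (B k) (x k) (x k.+1)).

Definition stops_at (x : nat -> 'cV[R]_n) (K : nat) : Prop :=
  grad f (x K) = 0 /\ forall k, (k < K)%N -> grad f (x k) <> 0.

End Method.

(* Main.v *)
Require Import Defs.
From mathcomp Require Import all_boot all_order all_algebra.
From mathcomp Require Import all_classical all_reals all_analysis.
From mathcomp Require Import ring lra.

Set Implicit Arguments.
Unset Strict Implicit.
Unset Printing Implicit Defensive.

Import Order.TTheory GRing.Theory Num.Theory.
Import numFieldNormedType.Exports.

Local Open Scope classical_set_scope.
Local Open Scope ring_scope.

(** Write [g = |grad f (x k)|], [st = |x (k+1) - x k|], [D = f (x k) - f (x (k+1))]
and [mu = min (Acap, a_k g^alpha)]. If [D >= c g st] held at every step, the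
Kurdyka-Lojasiewicz inequality would give steps of finite total length, as
[D <= g (phi_k - phi_(k+1))] for the desingularized values [phi_k]. The
directions of the method only satisfy, near the accumulation point, one of the
following, with a constant [c] that does not depend on [k] ([step_progress]):
- the direction is a multiple of the gradient, [D >= c g st] and
  [st >= c mu g];
- [D >= c nu st^2] and [st >= c g], where [nu] is [mu] or the regularization
  [zeta_k].

For the second alternative, set [nu = w g^e] and [om = w^(-1/e)]. Eliminating
[g] gives [c st^2 <= (phi_k - phi_(k+1)) g^(1-e) om^e], and since
[g^(1-e) om^e <= max (g, om)] and [g <= st / c], the step is at most a
constant times [phi_k - phi_(k+1) + om] ([weighted_step_le]). The terms [om]
are summable by assumption, hence the steps near the accumulation point are
bounded by the decrements of a potential tending to [0], which traps the
sequence ([potential_convergence]). The same alternative makes [D] bounded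
below near a nonstationary accumulation point, so the limit is stationary.

The bound [st >= c g] for short steps comes from the linesearch: if a trial
step [l] is rejected, Taylor's inequality with a Lipschitz Hessian
([cubic_growth]) shows that [l |d|] is at least a multiple of [zeta_k], because
the regularization makes [d^T H d <= - d^T grad f - zeta_k |d|^2] for the
iterates of MINRES on [(H + zeta_k I) d = - grad f], and
[d^T H d <= - zeta_k |d|^2] for directions of nonpositive curvature; and
[zeta_k] dominates [g] because its exponent is at most 1.

These facts on [d] hold for every truncation of MINRES. As long as residuals
have positive curvature, the steps of MINRES are nonnegative combinations of
the residuals ([delta_recurrence], [delta_cone]), which gives
[d^T A d <= d^T b] ([curvature_le_dot]). Moreover a first step shorter than
[b / |A|] would leave a residual of nonpositive curvature ([first_step_ge]);
so either the routine returns its first iterate, a multiple of [b], or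
[|b|^2 <= |A| d^T b], whence [|b| <= |A| |d|]. *)

(** * Euclidean norm on column vectors *)

Section EuclideanTheory.
Context {R : realType} {n : nat}.
Implicit Types (u v w : 'cV[R]_n) (M : 'M[R]_n) (c : R).

Lemma dotE u v : dot u v = \sum_i u i 0 * v i 0.
Proof. by rewrite /dot mxE; apply: eq_bigr => i _; rewrite mxE. Qed.

Lemma dotC u v : dot u v = dot v u.
Proof. by rewrite !dotE; apply: eq_bigr => i _; rewrite mulrC. Qed.

Lemma dotDl u v w : dot (u + v) w = dot u w + dot v w.
Proof. by rewrite /dot raddfD mulmxDl mxE. Qed.

Lemma dotDr u v w : dot w (u + v) = dot w u + dot w v.
Proof. by rewrite /dot mulmxDr mxE. Qed.

Lemma dotZl c u v : dot (c *: u) v = c * dot u v.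
Proof. by rewrite /dot linearZ /= -scalemxAl mxE. Qed.

Lemma dotZr c u v : dot u (c *: v) = c * dot u v.
Proof. by rewrite dotC dotZl dotC. Qed.

Lemma dotNl u v : dot (- u) v = - dot u v.
Proof. by rewrite -scaleN1r dotZl mulN1r. Qed.

Lemma dotNr u v : dot u (- v) = - dot u v.
Proof. by rewrite dotC dotNl dotC. Qed.

Lemma dotBl u v w : dot (u - v) w = dot u w - dot v w.
Proof. by rewrite dotDl dotNl. Qed.

Lemma dotBr u v w : dot w (u - v) = dot w u - dot w v.
Proof. by rewrite dotDr dotNr. Qed.

Lemma dot0l v : dot 0 v = 0.
Proof. by rewrite -(scale0r 0) dotZl mul0r. Qed.

Lemma dot0r v : dot v 0 = 0.
Proof. by rewrite dotC dot0l. Qed.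

Lemma dot_suml (I : Type) (s : seq I) (P : pred I) (F : I -> 'cV[R]_n) v :
  dot (\sum_(i <- s | P i) F i) v = \sum_(i <- s | P i) dot (F i) v.
Proof.
by elim/big_rec2: _ => [|i x y _ <-]; rewrite ?dot0l ?dotDl.
Qed.

Lemma dot_trmx M u v : dot u (M *m v) = dot (M^T *m u) v.
Proof. by rewrite /dot trmx_mul trmxK mulmxA. Qed.

Lemma dot_ge0 v : 0 <= dot v v.
Proof. by rewrite dotE sumr_ge0 // => i _; rewrite -expr2 sqr_ge0. Qed.

Lemma dot_eq0 v : dot v v = 0 -> v = 0.
Proof.
rewrite dotE => /psumr_eq0P v0; apply/matrixP => i j; rewrite mxE ord1.
by apply/eqP; rewrite -sqrf_eq0 expr2 v0 // => k _; rewrite -expr2 sqr_ge0.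
Qed.

Lemma dot_gt0 v : v != 0 -> 0 < dot v v.
Proof.
move=> v0; rewrite lt_def dot_ge0 andbT; apply: contra v0 => /eqP /dot_eq0 ->.
by [].
Qed.

Lemma enorm_ge0 v : 0 <= enorm v.
Proof. exact: sqrtr_ge0. Qed.

Lemma enorm_sqr v : enorm v ^+ 2 = dot v v.
Proof. by rewrite sqr_sqrtr // dot_ge0. Qed.

Lemma enorm_gt0 v : v != 0 -> 0 < enorm v.
Proof. by move=> v0; rewrite sqrtr_gt0 dot_gt0. Qed.

Lemma enorm_eq0 v : enorm v = 0 -> v = 0.
Proof. by move=> v0; apply: dot_eq0; rewrite -enorm_sqr v0 expr0n. Qed.

Lemma enorm0 : enorm (0 : 'cV[R]_n) = 0.
Proof. by rewrite /enorm dot0l sqrtr0. Qed.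

Lemma enormZ c v : enorm (c *: v) = `|c| * enorm v.
Proof.
by rewrite /enorm dotZl dotZr mulrA -expr2 sqrtrM ?sqr_ge0 // sqrtr_sqr.
Qed.

Lemma enormN v : enorm (- v) = enorm v.
Proof. by rewrite -scaleN1r enormZ normrN normr1 mul1r. Qed.

(** Cauchy-Schwarz, from the nonnegativity of the square of
    [enorm v *: u - enorm u *: v]. *)
Lemma dot_le u v : dot u v <= enorm u * enorm v.
Proof.
have [->|u0] := eqVneq u 0; first by rewrite dot0l enorm0 mul0r.
have [->|v0] := eqVneq v 0; first by rewrite dot0r enorm0 mulr0.
have := dot_ge0 (enorm v *: u - enorm u *: v).
rewrite dotBl !dotBr !dotZl !dotZr (dotC v u) -!enorm_sqr => h.
have hu := enorm_gt0 u0; have hv := enorm_gt0 v0.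
have p : 0 < enorm u * enorm v by rewrite mulr_gt0.
rewrite -(ler_pM2l p); lra.
Qed.

Lemma enormD u v : enorm (u + v) <= enorm u + enorm v.
Proof.
rewrite -(ler_pXn2r (ltn0Sn 1)) ?nnegrE ?addr_ge0 ?enorm_ge0 //.
rewrite enorm_sqr dotDl !dotDr (dotC v u) sqrrD -!enorm_sqr.
have := dot_le u v; lra.
Qed.

Lemma enorm_triangle v u w : enorm (u - w) <= enorm (u - v) + enorm (v - w).
Proof.
by rewrite (_ : u - w = (u - v) + (v - w)) ?enormD // addrA subrK.
Qed.

Lemma coord_le_norm v i : `|v i 0| <= `|v|.
Proof.
rewrite [leRHS]/Num.Def.normr /= mx_normrE; apply/bigmax_geP; right => /=.
by exists (i, 0).
Qed.

Lemma norm_le_enorm v : `|v| <= enorm v.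
Proof.
rewrite [leLHS]/Num.Def.normr /= mx_normrE; apply/bigmax_leP; split=> [|[i j] _] /=.
  exact: enorm_ge0.
rewrite ord1 -(ler_pXn2r (ltn0Sn 1)) ?nnegrE ?enorm_ge0 // enorm_sqr.
rewrite real_normK ?num_real //.
rewrite dotE (bigD1 i) //= -expr2 lerDl sumr_ge0 // => k _.
by rewrite -expr2 sqr_ge0.
Qed.

Lemma enorm_le_norm v : enorm v <= n.+1%:R * `|v|.
Proof.
rewrite -(ler_pXn2r (ltn0Sn 1)) ?nnegrE ?enorm_ge0 ?mulr_ge0 // enorm_sqr.
have le_i i : v i 0 * v i 0 <= `|v| ^+ 2.
  by rewrite -expr2 -real_normK ?num_real // ler_pXn2r ?nnegrE // coord_le_norm.
rewrite dotE; apply: le_trans (ler_sum _ (fun i _ => le_i i)) _.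
rewrite sumr_const card_ord -[leLHS]mulr_natl exprMn ler_wpM2r ?sqr_ge0 //.
by rewrite -natrX ler_nat (leq_trans (leqnSn n)) // -[leqLHS]expn1 leq_pexp2l.
Qed.

Lemma nbhs_enormP (x : 'cV[R]_n) (P : set 'cV[R]_n) :
  nbhs x P <-> exists2 r : R, 0 < r & forall y, enorm (y - x) < r -> P y.
Proof.
split=> [/nbhs_normP[r /= r0 rP]|[r r0 rP]].
  exists r => // y yx; apply: rP => /=.
  by rewrite distrC (le_lt_trans (norm_le_enorm _)).
rewrite -nbhs_nbhs_norm; exists (r / n.+1%:R) => /=; first by rewrite divr_gt0.
move=> y /=; rewrite distrC => yx; apply: rP.
apply: le_lt_trans (enorm_le_norm _) _.
by rewrite mulrC -ltr_pdivlMr.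
Qed.

Lemma enorm_mulmx_le M (m : R) u : (forall i j, `|M i j| <= m) ->
  enorm (M *m u) <= n.+1%:R * (n.+1%:R * m) * enorm u.
Proof.
move=> Mm; have [n0|i0] := posnP n.
  have -> : u = 0 by subst n; apply/matrixP => -[].
  by rewrite mulmx0 enorm0 mulr0.
have m0 : 0 <= m := le_trans (normr_ge0 _) (Mm (Ordinal i0) (Ordinal i0)).
apply: le_trans (enorm_le_norm _) _; rewrite -!mulrA ler_wpM2l //.
rewrite [leLHS]/Num.Def.normr /= mx_normrE; apply/bigmax_leP; split=> [|[i j] _] /=.
  by rewrite !mulr_ge0 ?enorm_ge0.
rewrite ord1 mxE; apply: le_trans (ler_norm_sum _ _ _) _.
have le_k k : `|M i k * u k 0| <= m * enorm u.
  rewrite normrM ler_pM //.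
  exact: le_trans (coord_le_norm _ _) (norm_le_enorm _).
apply: le_trans (ler_sum _ (fun k _ => le_k k)) _.
rewrite sumr_const card_ord -[leLHS]mulr_natl ler_wpM2r ?mulr_ge0 ?enorm_ge0 //.
by rewrite ler_nat leqnSn.
Qed.

Lemma matrix_bounded M : exists2 m : R, 0 <= m &
  forall u, enorm (M *m u) <= m * enorm u.
Proof.
exists (n.+1%:R * (n.+1%:R * `|M|)) => [|u]; first by rewrite !mulr_ge0.
apply: enorm_mulmx_le => i j.
rewrite [leRHS]/Num.Def.normr /= mx_normrE; apply/bigmax_geP; right => /=.
by exists (i, j).
Qed.

(** Boundedness makes the supremum in [specnorm] a genuine upper bound; the
    default value of [sup] is never reached. *)
Lemma specnorm_le M u : enorm (M *m u) <= specnorm M * enorm u.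
Proof.
have [->|u0] := eqVneq u 0; first by rewrite mulmx0 enorm0 mulr0.
have up := enorm_gt0 u0.
have -> : M *m u = enorm u *: (M *m ((enorm u)^-1 *: u)).
  by rewrite -scalemxAr scalerA divff ?gt_eqF // scale1r.
rewrite enormZ ger0_norm ?enorm_ge0 // mulrC ler_wpM2r ?enorm_ge0 //.
have [m m0 Mm] := matrix_bounded M.
apply: ub_le_sup.
  exists m => _ [w /= w1 <-]; apply: le_trans (Mm w) _.
  by rewrite -[leRHS]mulr1 ler_wpM2l.
exists ((enorm u)^-1 *: u) => //=.
by rewrite enormZ ger0_norm ?invr_ge0 ?enorm_ge0 // mulVf ?gt_eqF.
Qed.

End EuclideanTheory.

(** * Krylov spaces and MINRES iterates *)

Section MinresTheory.
Context {R : realType} {n : nat}.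
Variables (A : 'M[R]_n) (b : 'cV[R]_n).
Hypothesis A_sym : A^T = A.
Local Notation K := (krylov A b).

Lemma dot_mulmxC (u v : 'cV[R]_n) : dot u (A *m v) = dot (A *m u) v.
Proof. by rewrite dot_trmx A_sym. Qed.

Lemma krylov0 q : q \in K 0%N -> q = 0.
Proof. by rewrite /krylov /= span_nil memv0 => /eqP. Qed.

Lemma krylovS t : K t.+1 = (K t + <[A ^+ t *m b]>)%VS.
Proof.
by rewrite /krylov -[t.+1]addn1 iotaD map_cat span_cat /= add0n span_seq1.
Qed.

Lemma krylov_subS t q : q \in K t -> q \in K t.+1.
Proof. by move=> qK; rewrite krylovS (subvP (addvSl _ _)). Qed.

Lemma krylov_sub i j q : (i <= j)%N -> q \in K i -> q \in K j.
Proof.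
move=> /subnK <-; elim: (j - i)%N => [//|k IH] qK.
by rewrite addSn; apply: krylov_subS; exact: IH.
Qed.

Lemma krylov_b t : b \in K t.+1.
Proof.
apply: (@krylov_sub 1) => //; apply: memv_span.
by rewrite /= mem_seq1 expr0 mul1mx.
Qed.

Lemma krylov_mulmx t q : q \in K t -> A *m q \in K t.+1.
Proof.
elim: t q => [|t IH] q; first by move/krylov0 ->; rewrite mulmx0 mem0v.
rewrite krylovS => /memv_addP[u uK [_ /vlineP[c ->] ->]].
rewrite mulmxDr rpredD //; first by apply: krylov_subS; exact: IH.
rewrite -scalemxAr rpredZ // mulmxA -[A *m _]exprS [K _]krylovS.
by apply: (subvP (addvSr _ _)); exact: memv_line.
Qed.

(** Otherwise removing from [r] its projection on [y] would shorten it. *)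
Lemma shortest_orthogonal (r y : 'cV[R]_n) :
  (forall e, enorm r <= enorm (r - e *: y)) -> dot r y = 0.
Proof.
move=> rmin; have [->|y0] := eqVneq y 0; first by rewrite dot0r.
have yy := dot_gt0 y0; pose e := dot r y / dot y y.
have := rmin e; rewrite -(ler_pXn2r (ltn0Sn 1)) ?nnegrE ?enorm_ge0 //.
rewrite !enorm_sqr dotBl !dotBr !dotZl !dotZr (dotC y r).
have -> : e * (e * dot y y) = e * dot r y by rewrite /e divfK ?gt_eqF.
have -> : e * dot r y = dot r y ^+ 2 / dot y y by rewrite /e; ring.
move=> h; have : dot r y ^+ 2 / dot y y <= 0 by lra.
rewrite pmulr_lle0 ?invr_gt0 // => h2.
by apply/eqP; rewrite -sqrf_eq0 eq_le h2 sqr_ge0.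
Qed.

Lemma argmin_orthogonal t p q : krylov_argmin A b t p -> q \in K t ->
  dot (b - A *m p) (A *m q) = 0.
Proof.
move=> [pK pmin] qK; apply: shortest_orthogonal => e.
have -> : b - A *m p - e *: (A *m q) = b - A *m (p + e *: q).
  by rewrite mulmxDr -scalemxAr opprD addrA.
by apply: pmin; rewrite rpredD // rpredZ.
Qed.

Variables (p : nat -> 'cV[R]_n) (t : nat).
Hypothesis p0 : p 0%N = 0.
Hypothesis p_min : forall i, (0 < i <= t)%N -> krylov_argmin A b i (p i).
Let r i := b - A *m p i.

Lemma res0 : r 0 = b.
Proof. by rewrite /r p0 mulmx0 subr0. Qed.

Lemma iterate_krylov i : (i <= t)%N -> p i \in K i.
Proof.
by case: i => [_|i it]; [rewrite p0 mem0v | case: (p_min (i := i.+1) it)].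
Qed.

Lemma res_krylov i : (i <= t)%N -> r i \in K i.+1.
Proof.
move=> it; rewrite rpredB ?krylov_b // krylov_mulmx // iterate_krylov //.
Qed.

Lemma res_orthogonal i q : (i <= t)%N -> q \in K i -> dot (r i) (A *m q) = 0.
Proof.
case: i => [_ /krylov0 ->|i it]; first by rewrite mulmx0 dot0r.
by apply: argmin_orthogonal; apply: p_min.
Qed.

Lemma dot_res i j : (i <= j)%N -> (j <= t)%N -> dot (r i) (r j) = dot (r j) (r j).
Proof.
move=> ij jt; have to_b k : (k <= j)%N -> dot (r k) (r j) = dot b (r j).
  move=> kj; rewrite {1}/r dotBl (dotC (A *m _)) res_orthogonal ?subr0 //.
  by exact: krylov_sub (kj) (iterate_krylov (leq_trans kj jt)).
by rewrite !to_b.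
Qed.

Lemma dot_b_res j : (j <= t)%N -> dot b (r j) = dot (r j) (r j).
Proof. by move=> jt; rewrite -(dot_res (leq0n j) jt) res0. Qed.

Hypothesis r_curv : forall i, (i < t)%N -> 0 < dot (r i) (A *m r i).

(** Positive curvature keeps [r i] out of [K i], because [r i] is orthogonal to
    [A K i]; so [r i] can replace the power [A ^+ i *m b] as a new generator. *)
Lemma krylovS_res i q : (i < t)%N -> q \in K i.+1 ->
  exists (c : R) u, u \in K i /\ q = c *: r i + u.
Proof.
move=> it; have := res_krylov (ltnW it).
rewrite krylovS => /memv_addP[u uK [_ /vlineP[c ->] rE]].
have c0 : c != 0.
  apply/eqP => c0; have := r_curv it.
  by rewrite res_orthogonal ?ltxx ?(ltnW it) // rE c0 scale0r addr0.
move=> /memv_addP[v vK [_ /vlineP[c' ->] ->]].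
exists (c' / c), (v - (c' / c) *: u); split; first by rewrite rpredB // rpredZ.
by rewrite rE scalerDr scalerA divfK // [RHS]addrC [RHS]addrA subrK.
Qed.

(** A vector [c *: r i + u] killed by [A] has [c = 0], by pairing with
    [A r i]. *)
Lemma krylov_mulmx_inj i q : (i <= t)%N -> q \in K i -> A *m q = 0 -> q = 0.
Proof.
elim: i q => [|i IH] q it; first by move=> /krylov0.
move=> /(krylovS_res it)[c [u [uK ->]]] Aq0.
have : dot (r i) (A *m (c *: r i + u)) = 0 by rewrite Aq0 dot0r.
rewrite mulmxDr -scalemxAr dotDr dotZr (res_orthogonal (ltnW it) uK) addr0.
move/eqP; rewrite mulf_eq0 (gt_eqF (r_curv it)) orbF => /eqP c0.
by move: Aq0; rewrite c0 scale0r add0r; apply: IH => //; exact: ltnW.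
Qed.

Let delta i := p i.+1 - p i.

Lemma mul_delta i : A *m delta i = r i - r i.+1.
Proof. by rewrite /delta /r mulmxBr opprB [RHS]addrC [RHS]addrA subrK. Qed.

Lemma delta_krylov i : (i < t)%N -> delta i \in K i.+1.
Proof.
move=> it; rewrite rpredB ?iterate_krylov //; apply: krylov_subS.
by rewrite iterate_krylov // ltnW.
Qed.

Lemma delta_orthogonal i q : (i < t)%N -> q \in K i ->
  dot (A *m delta i) (A *m q) = 0.
Proof.
move=> it qK; rewrite mul_delta dotBl !res_orthogonal ?subr0 //.
  exact: krylov_subS.
exact: ltnW.
Qed.

Lemma delta_gt0 i : (i < t)%N -> 0 < dot (A *m delta i) (A *m delta i).
Proof.
move=> it; apply: dot_gt0; apply/eqP; rewrite mul_delta => /subr0_eq rE.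
have := r_curv it; rewrite {1}rE (res_orthogonal it) ?ltxx //.
exact: res_krylov (ltnW it).
Qed.

Lemma delta_res i : (i < t)%N -> exists (g : R) u,
  [/\ 0 < g, u \in K i & delta i = g *: r i + u].
Proof.
move=> it; have [g [u [uK dE]]] := krylovS_res it (delta_krylov it).
exists g, u; split=> //.
have : dot (r i) (A *m delta i) = dot (A *m delta i) (A *m delta i).
  transitivity (dot (A *m delta i + r i.+1) (A *m delta i)).
    by rewrite mul_delta subrK.
  by rewrite dotDl (res_orthogonal it (delta_krylov it)) addr0.
rewrite {1}dE mulmxDr -scalemxAr dotDr dotZr (res_orthogonal (ltnW it) uK).
rewrite addr0 => h.
by rewrite -(pmulr_lgt0 g (r_curv it)) h delta_gt0.
Qed.

(** The recurrence of the conjugate residual method, recovered from the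
    minimality of the iterates. The part [q] of [delta i.+1] outside [r i.+1]
    lies in [K i.+1] and [A q] is orthogonal to [A K i]; as [delta i] has the
    same two properties and [A] is injective on [K i.+1], [q] is a multiple of
    [delta i]. Pairing with [A delta i] identifies this multiple as
    [g * dot (r i.+1) (A r i.+1) / |A delta i|^2]. *)
Lemma delta_recurrence i : (i.+1 < t)%N -> exists g k : R,
  [/\ 0 < g, 0 <= k & delta i.+1 = g *: r i.+1 + k *: delta i].
Proof.
move=> it; have it' := ltnW it.
have [g [q [g0 qK dE]]] := delta_res it.
have [g' [u' [g'0 u'K dE']]] := delta_res it'.
have [c [u [uK qE]]] := krylovS_res it' qK.
pose k := c / g'; pose w := u - k *: u'.
have wK : w \in K i by rewrite rpredB // rpredZ.
have qE' : q = k *: delta i + w.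
  rewrite qE dE' (scalerDr k (g' *: r i)) (scalerA k g') /w /k divfK ?gt_eqF //.
  by rewrite -[RHS]addrA [_ + (u - _)]addrC subrK.
have AqE : A *m q = A *m delta i.+1 - g *: (A *m r i.+1).
  by rewrite scalemxAr -(mulmxBr A (delta i.+1)) dE addrAC subrr add0r.
have Aq v : v \in K i -> dot (A *m q) (A *m v) = 0.
  move=> vK; rewrite AqE dotBl dotZl (delta_orthogonal it) ?krylov_subS //.
  by rewrite -dot_mulmxC (res_orthogonal it') ?krylov_mulmx // mulr0 subrr.
have Aw : A *m w = 0.
  apply: dot_eq0; have := Aq _ wK.
  by rewrite {1}qE' mulmxDr -scalemxAr dotDl dotZl (delta_orthogonal it' wK) mulr0 add0r.
have w0 : w = 0 by apply: (krylov_mulmx_inj (ltnW it')).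
exists g, k; split=> //; last by rewrite dE qE' w0 addr0.
have : dot (A *m delta i) (A *m q) = k * dot (A *m delta i) (A *m delta i).
  by rewrite qE' w0 addr0 -scalemxAr dotZr.
rewrite AqE dotBr dotZr [X in X - _]dotC.
rewrite (delta_orthogonal it (delta_krylov it')) sub0r mul_delta dotBl.
rewrite dot_mulmxC (dotC (A *m r i)) (res_orthogonal it') ?res_krylov ?(ltnW it') //.
rewrite sub0r mulrN opprK => h.
have d0 := delta_gt0 it'; rewrite -(pmulr_lge0 k d0) mul_delta -h.
by rewrite mulr_ge0 ?(ltW g0) // ltW // r_curv.
Qed.

(** The steps lie in the convex cone spanned by the residuals; the cone is
    described by its dual, which is what an induction on [delta_recurrence]
    needs. *)
Lemma delta_cone i y : (i < t)%N ->
  (forall j, (j <= i)%N -> 0 <= dot (r j) y) -> 0 <= dot (delta i) y.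
Proof.
elim: i => [|i IH] it ry.
  have [g [u [g0 uK ->]]] := delta_res it.
  by rewrite (krylov0 uK) addr0 dotZl mulr_ge0 ?(ltW g0) ?ry.
have [g [k [g0 k0 ->]]] := delta_recurrence it.
rewrite dotDl !dotZl addr_ge0 // mulr_ge0 ?(ltW g0) ?ry //.
by apply: IH => [|j ji]; [exact: ltnW | apply: ry; exact: leqW].
Qed.

Lemma iterateE i : p i = \sum_(j < i) delta j.
Proof.
elim: i => [|i IH]; first by rewrite big_ord0 p0.
by rewrite big_ord_recr /= -IH /delta addrC subrK.
Qed.

(** All residuals have the same scalar product with the last one, its squared
    norm, so every step has a nonnegative product with it. *)
Lemma iterate_res_ge0 : 0 <= dot (p t) (r t).
Proof.
rewrite iterateE dot_suml sumr_ge0 // => i _; apply: delta_cone => // j ji.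
rewrite dot_res ?dot_ge0 //; apply: leq_trans ji _; exact: ltnW.
Qed.

Lemma curvature_le_dot : dot (p t) (A *m p t) <= dot (p t) b.
Proof. by have := iterate_res_ge0; rewrite /r dotBr subr_ge0. Qed.

Lemma first_step : (0 < t)%N -> exists g : R, [/\ 0 < g, p 1 = g *: b &
  g * dot b b <= dot (p t) b].
Proof.
move=> t0; have [g [u [g0 uK dE]]] := delta_res t0.
have dE0 : delta 0 = g *: b by rewrite dE (krylov0 uK) addr0 res0.
exists g; split=> //; first by rewrite -dE0 /delta p0 subr0.
rewrite -dotZl -dE0 iterateE -(prednK t0) big_ord_recl dotDl lerDl dot_suml.
rewrite sumr_ge0 // => i _.
have it : (lift ord0 i < t)%N by rewrite lift0 -ltn_predRL ltn_ord.
apply: delta_cone => // j ji.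
by rewrite dotC dot_b_res ?dot_ge0 // (leq_trans ji) // ltnW.
Qed.

(** The residual [r 1] of a first step [g *: b] has curvature
    [g^2 dot (A b) (A (A b)) - g |A b|^2], which is positive only when
    [g m > 1]. *)
Lemma first_step_ge (m g : R) : (1 < t)%N -> 0 < g -> p 1 = g *: b ->
  (forall u, enorm (A *m u) <= m * enorm u) -> 1 <= g * m.
Proof.
move=> t1 g0 p1 Am; have := r_curv t1.
have r1 : r 1 = b - g *: (A *m b) by rewrite /r p1 -scalemxAr.
have b1 : b \in K 1 := krylov_b 0.
rewrite {2}r1 mulmxBr dotBr (res_orthogonal (ltnW t1) b1) -scalemxAr dotZr.
rewrite r1 dotBl dotZl dot_mulmxC sub0r.
set y := A *m b => h.
have yAy : dot y (A *m y) <= m * dot y y.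
  apply: le_trans (dot_le _ _) _; rewrite -enorm_sqr mulrC expr2 mulrA.
  by rewrite ler_wpM2r ?enorm_ge0.
have y0 : 0 < dot y y.
  apply: dot_gt0; apply/eqP => y0; move: h.
  by rewrite y0 mulmx0 !dot0r mulr0 subr0 mulr0 oppr0 ltxx.
move: h; rewrite oppr_gt0 pmulr_rlt0 // subr_lt0 => h.
rewrite -(ler_pM2r y0) mul1r; apply: ltW; apply: lt_le_trans h _.
by rewrite -mulrA ler_pM2l.
Qed.

End MinresTheory.

(** * Directions returned by MINRES *)

Section MinresDirections.
Context {R : realType} {n : nat}.
Implicit Types (A : 'M[R]_n) (b d : 'cV[R]_n).

(** The iterate returned is the last of a run along which all residuals have
    positive curvature. After a single iteration it is a multiple of [b], with
    the factor of the exact line minimization; after more, the first step alone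
    contributes at least [dot b b / m] to [dot d b]. *)
Lemma minres_SOLP A b d (theta m : R) : A^T = A -> b != 0 ->
  (forall u, enorm (A *m u) <= m * enorm u) -> minres A b theta d SOL ->
  [/\ 0 < dot d b, dot d (A *m d) <= dot d b &
      (exists g : R, [/\ 0 < g, d = g *: b &
         g * dot (A *m b) (A *m b) = dot b (A *m b)]) \/ dot b b <= m * dot d b].
Proof.
move=> A_sym b0 Am [t [p [t0 [p0 p_min] r_curv [[]//|[r_last _ _ ->]]]]].
have curv i : (i < t)%N -> 0 < dot (b - A *m p i) (A *m (b - A *m p i)).
  move=> it; have [it'|it'] := ltnP i.+1 t; first exact: (r_curv i.+1 it').1.
  by have -> : i = t.-1 by apply/eqP; rewrite -eqSS prednK // eqn_leq it it'.
have [g [g0 p1 ge_g]] := first_step A_sym p0 p_min curv t0.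
have bb := dot_gt0 b0.
split; first by apply: lt_le_trans ge_g; rewrite mulr_gt0.
  by have := curvature_le_dot A_sym p0 p_min curv.
have [t1|t1] := ltnP 1 t; last first.
  have tE : t = 1%N by apply/eqP; rewrite eqn_leq t1.
  left; exists g; split; [by []|by rewrite tE|].
  apply/eqP; rewrite eq_sym -subr_eq0 -dotZl -dotBl scalemxAr -p1; apply/eqP.
  apply: (argmin_orthogonal (t := 1%N)); last exact: krylov_b.
  by apply: p_min; rewrite tE.
right; have gm := first_step_ge A_sym p_min curv t1 g0 p1 Am.
have m0 : 0 <= m by rewrite -(pmulr_rge0 m g0) (le_trans ler01).
apply: le_trans (ler_wpM2l m0 ge_g).
by rewrite mulrA ler_peMl ?(ltW bb) // mulrC.
Qed.

(** The last residual [r] satisfies [dot r b = dot r r], and it is nonzero: the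
    previous tolerance test failed, or it is [b]. *)
Lemma minres_NPCP A b d (theta : R) : b != 0 -> 0 <= theta ->
  minres A b theta d NPC ->
  [/\ enorm d = enorm b, 0 < dot d b & dot d (A *m d) <= 0].
Proof.
move=> b0 theta0 [t [p [t0 [p0 p_min] r_curv [[curv _ ->]|[]//]]]].
move: curv; set r := b - A *m p t.-1 => curv.
have rr : dot r b = dot r r.
  by rewrite dotC (dot_b_res p0 p_min) // leq_pred.
have r0 : 0 < enorm r.
  have [t1|t1] := ltnP 1 t.
    apply: le_lt_trans (r_curv t.-1 _).2; first by rewrite mulr_ge0 ?enorm_ge0.
    by rewrite ltn_predRL t1 ltn_predL.
  have -> : r = b by rewrite /r -subn1 (eqP t1) p0 mulmx0 subr0.
  exact: enorm_gt0.
have eb := enorm_gt0 b0.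
have c0 : 0 < enorm b / enorm r by rewrite divr_gt0.
split; last 2 first.
- by rewrite dotZl rr -enorm_sqr mulr_gt0 // exprn_gt0.
- by rewrite -scalemxAr dotZl dotZr mulrA pmulr_rle0 // mulr_gt0.
by rewrite enormZ ger0_norm ?(ltW c0) // divfK ?gt_eqF.
Qed.

Lemma minres_GDP A b d (theta : R) : ~ minres A b theta d GD.
Proof. by case=> t [p [_ _ _ [[]|[]]]]. Qed.

End MinresDirections.

(** * Taylor's inequality on a segment *)

Section Taylor.
Context {R : realType}.

Lemma le0_of_is_derive (F dF : R -> R) (l : R) : 0 <= l ->
  (forall t, 0 <= t <= l -> is_derive t (1 : R) F (dF t)) ->
  (forall t, 0 <= t <= l -> dF t <= 0) -> F 0 <= 0 -> F l <= 0.
Proof.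
move=> l0 FdF dF0 F0.
have [x|x|c cl] := @MVT_segment R F dF 0 l l0.
- by rewrite in_itv /= => /andP[x0 xl]; apply: FdF; rewrite !ltW.
- move: x; apply: derivable_within_continuous => x; rewrite in_itv /= => xl.
  by case: (FdF _ xl).
rewrite in_itv /= in cl; rewrite subr0 => FE.
have : dF c * l <= 0 by rewrite mulr_le0_ge0 // dF0.
lra.
Qed.

(** The bound on the second derivative is integrated twice. *)
Lemma taylor_le (phi phi1 phi2 : R -> R) (q k l : R) : 0 <= l ->
  (forall t, 0 <= t <= l -> is_derive t (1 : R) phi (phi1 t)) ->
  (forall t, 0 <= t <= l -> is_derive t (1 : R) phi1 (phi2 t)) ->
  (forall t, 0 <= t <= l -> phi2 t <= q + k * t) ->
  phi l <= phi 0 + l * phi1 0 + q / 2 * l ^+ 2 + k / 6 * l ^+ 3.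
Proof.
move=> l0 d1 d2 phi2_le.
have step1 t : 0 <= t <= l -> phi1 t - phi1 0 - q * t - k / 2 * t ^+ 2 <= 0.
  move=> /andP[t0 tl].
  pose F u := phi1 u - phi1 0 - q * u - k / 2 * u ^+ 2.
  apply: (@le0_of_is_derive F (fun u => phi2 u - q - k * u)) => //.
  - move=> u /andP[u0 ut]; have ul : 0 <= u <= l by rewrite u0 (le_trans ut).
    have := d2 u ul => du; apply: is_derive_eq.
    by rewrite /GRing.scale /=; lra.
  - move=> u /andP[u0 ut]; have := @phi2_le u.
    by rewrite u0 (le_trans ut) // => /(_ isT); lra.
  - by rewrite /F; lra.
pose F u := phi u - phi 0 - u * phi1 0 - q / 2 * u ^+ 2 - k / 6 * u ^+ 3.
suff : F l <= 0 by rewrite /F; lra.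
apply: (@le0_of_is_derive F (fun u => phi1 u - phi1 0 - q * u - k / 2 * u ^+ 2)) => //.
- move=> u ul; have := d1 u ul => du; apply: is_derive_eq.
  by rewrite /GRing.scale /=; lra.
- by rewrite /F expr0n /=; lra.
Qed.

Context {n : nat}.
Implicit Types (f h : 'cV[R]_n -> R) (x d : 'cV[R]_n).

Lemma is_derive_line h x d (t : R) : differentiable h (x + t *: d) ->
  is_derive t (1 : R) (fun u => h (x + u *: d)) ('d h (x + t *: d) d).
Proof.
move=> hd.
(* both difference quotients are the same function *)
have E : (fun s : R => s^-1 *: (((fun u => h (x + u *: d)) \o shift t)
      (s *: (1 : R)) - h (x + t *: d)))
   = (fun s : R => s^-1 *: ((h \o shift (x + t *: d)) (s *: d) - h (x + t *: d))).
  apply/funext => s /=; congr (_ *: (h _ - _)).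
  by rewrite -[s *: (1 : R)]/(s * 1) mulr1 scalerDl addrCA.
apply: DeriveDef; first by rewrite /derivable E; exact: diff_derivable.
by rewrite /derive E -/(derive h (x + t *: d) d) deriveE.
Qed.

Lemma diff_gradE h x d : differentiable h x -> 'd h x d = dot d (grad h x).
Proof.
move=> hd; have -> : d = \sum_i d i 0 *: delta_mx i 0.
  by rewrite {1}[d]matrix_sum_delta; apply: eq_bigr => i _; rewrite big_ord1.
rewrite linear_sum dot_suml; apply: eq_bigr => i _.
rewrite linearZ dotZl -deriveE //=; congr (_ * _).
rewrite dotE (bigD1 i) //= big1 => [|j ji]; first by rewrite !mxE !eqxx mul1r addr0.
by rewrite !mxE (negbTE ji) mul0r.
Qed.

Variable f : 'cV[R]_n -> R.
Hypothesis f_C2 : twice_continuously_differentiable f.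

Lemma is_derive_grad x d (t : R) :
  is_derive t (1 : R) (fun u => f (x + u *: d)) (dot d (grad f (x + t *: d))).
Proof.
case: f_C2 => df _ _; rewrite -diff_gradE //.
exact: is_derive_line.
Qed.

Lemma is_derive_hess x d (t : R) :
  is_derive t (1 : R) (fun u => dot d (grad f (x + u *: d)))
    (dot d (hess f (x + t *: d) *m d)).
Proof.
case: f_C2 => _ dg _.
have dpart i : differentiable (partial i f) (x + t *: d).
  have -> : partial i f = (fun N : 'cV[R]_n => N i 0) \o grad f.
    by apply/funext => y; rewrite /= mxE.
  by apply: differentiable_comp => //; exact: differentiable_coord.
have H i := is_derive_line (dpart i).
have -> : (fun u => dot d (grad f (x + u *: d))) =
    \sum_i (fun u => d i 0 * partial i f (x + u *: d)).
  apply/funext => u; rewrite dotE fct_sumE; apply: eq_bigr => i _.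
  by rewrite mxE.
have -> : dot d (hess f (x + t *: d) *m d) =
    \sum_i d i 0 *: 'd (partial i f) (x + t *: d) d.
  rewrite dotE; apply: eq_bigr => i _; rewrite diff_gradE //.
  congr (_ * _); rewrite mxE dotE; apply: eq_bigr => j _.
  by rewrite !mxE mulrC.
apply: is_derive_sum => i; exact: is_deriveZ.
Qed.

(** The affine bound [q + k t] serves both for a bounded Hessian ([k = 0]) and
    for a Lipschitz one ([q] the curvature at [x]). *)
Lemma taylor_line x d (q k l : R) : 0 <= l ->
  (forall t, 0 <= t <= l -> dot d (hess f (x + t *: d) *m d) <= q + k * t) ->
  f (x + l *: d) <=
    f x + l * dot d (grad f x) + q / 2 * l ^+ 2 + k / 6 * l ^+ 3.
Proof.
move=> l0 hq.
have := taylor_le l0 (fun t _ => is_derive_grad x d t)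
  (fun t _ => is_derive_hess x d t) hq.
by rewrite scale0r addr0.
Qed.

End Taylor.

(** * Linesearch steps near a point *)

Section Linesearch.
Context {R : realType} {n : nat}.
Variables (f : 'cV[R]_n -> R) (rho sigma s : R) (x d : 'cV[R]_n) (l : R).
Hypotheses (rho01 : 0 < rho < 1) (s_gt0 : 0 < s).

(** In both linesearches, a step below [s] was preceded by a rejected trial
    [l'], and only this trial bounds the step from below. *)
Lemma backtrackingP : backtracking f rho sigma s x d l ->
  [/\ 0 < l <= s, armijo f sigma x d l &
      l = s \/ exists2 l', l = rho * l' & 0 < l' /\ ~ armijo f sigma x d l'].
Proof.
have /andP[rho0 rho1] := rho01.
move=> [j [-> armj fails]]; split=> //.
  rewrite mulr_gt0 ?exprn_gt0 //= ger_pMr // exprn_ile1 // ltW //.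
case: j armj fails => [|j] _ fails; first by left; rewrite expr0 mulr1.
right; exists (s * rho ^+ j); first by rewrite exprS mulrCA.
by rewrite mulr_gt0 ?exprn_gt0 //; split=> //; exact: fails.
Qed.

Lemma curvature_linesearchP (B : 'M[R]_n) :
  curvature_linesearch f rho sigma s B x d l ->
  [/\ 0 < l, curvature_armijo f sigma B x d l &
      s <= l \/
      exists2 l', l = rho * l' & 0 < l' /\ ~ curvature_armijo f sigma B x d l'].
Proof.
have /andP[rho0 rho1] := rho01.
case=> [[nCs [j [j0 -> Cj fails]]]|[Cs [j [-> Cj _]]]].
  split=> //; first by rewrite mulr_gt0 ?exprn_gt0.
  right; exists (s * rho ^+ j.-1); first by rewrite mulrCA -exprS prednK.
  rewrite mulr_gt0 ?exprn_gt0 //; split=> //.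
  case: j j0 fails {Cj} => // -[|j] _ fails; first by rewrite expr0 mulr1.
  by apply: fails; rewrite /= ltnSn.
split; [by rewrite divr_gt0 ?exprn_gt0 | exact: Cj | left].
rewrite ler_peMr ?(ltW s_gt0) // invr_ge1 ?unitfE ?gt_eqF ?exprn_gt0 //.
by rewrite exprn_ile1 // ltW.
Qed.

End Linesearch.

Section StepProgress.
Context {R : realType}.

(** How a step of length [st] decreases the objective by [D] where the gradient
    has norm [g]; [mu] is the curvature threshold of the method and [zt] its
    regularization. The first alternative is that of steps along the gradient,
    the second that of Newton and of nonpositive-curvature steps. *)
Definition sufficient_progress (c mu zt g st D : R) : Prop :=
  (c * g * st <= D /\ c * mu * g <= st) \/
  (exists2 nu, nu = mu \/ nu = zt & c * nu * st ^+ 2 <= D /\ c * g <= st).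

Lemma sufficient_progress_le (c c' mu zt g st D : R) : c' <= c ->
  0 <= mu -> 0 <= zt -> 0 <= g -> 0 <= st ->
  sufficient_progress c mu zt g st D -> sufficient_progress c' mu zt g st D.
Proof.
move=> cc mu0 zt0 g0 st0 [[D1 st1]|[nu nuE [D1 st1]]]; [left|right].
  split; [apply: le_trans D1 | apply: le_trans st1].
    by rewrite -!mulrA ler_wpM2r // mulr_ge0.
  by rewrite -!mulrA ler_wpM2r // mulr_ge0.
exists nu => //; split; [apply: le_trans D1 | apply: le_trans st1].
  by rewrite -!mulrA ler_wpM2r // mulr_ge0 ?sqr_ge0 //; case: nuE => ->.
by rewrite ler_wpM2r.
Qed.

Context {n : nat}.
Variables (f : 'cV[R]_n -> R) (xs : 'cV[R]_n) (r M L G : R).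
Hypothesis f_C2 : twice_continuously_differentiable f.
Hypotheses (r_gt0 : 0 < r) (M_ge1 : 1 <= M) (L_gt0 : 0 < L) (G_gt0 : 0 < G).
Hypothesis hess_le : forall y u : 'cV[R]_n, enorm (y - xs) < r ->
  enorm (hess f y *m u) <= M * enorm u.
Hypothesis hess_lip : forall y y' u : 'cV[R]_n,
  enorm (y - xs) < r -> enorm (y' - xs) < r ->
  enorm ((hess f y - hess f y') *m u) <= L * enorm (y - y') * enorm u.
Hypothesis grad_le : forall y : 'cV[R]_n, enorm (y - xs) < r ->
  enorm (grad f y) <= G.

Variables (x d : 'cV[R]_n).
Hypothesis x_near : enorm (x - xs) < r / 2.
Let g := enorm (grad f x).
Let tau := - dot d (grad f x).

Lemma x_ball : enorm (x - xs) < r.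
Proof. by apply: lt_trans x_near _; have := r_gt0; lra. Qed.

Lemma segment_ball (l t : R) : l * enorm d < r / 2 -> 0 <= t <= l ->
  enorm (x + t *: d - xs) < r.
Proof.
move=> ld /andP[t0 tl].
have -> : x + t *: d - xs = (x - xs) + t *: d by rewrite addrAC.
apply: le_lt_trans (enormD _ _) _; rewrite enormZ ger0_norm //.
have : t * enorm d <= l * enorm d by rewrite ler_wpM2r ?enorm_ge0.
have := x_near; lra.
Qed.

Lemma quadratic_growth (l : R) : 0 <= l -> l * enorm d < r / 2 ->
  f (x + l *: d) - f x <= - l * tau + M / 2 * (l * enorm d) ^+ 2.
Proof.
move=> l0 ld.
have hq t : 0 <= t <= l ->
    dot d (hess f (x + t *: d) *m d) <= M * enorm d ^+ 2 + 0 * t.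
  move=> tl; rewrite mul0r addr0; apply: le_trans (dot_le _ _) _.
  rewrite expr2 mulrA mulrC ler_wpM2r ?enorm_ge0 //.
  exact: hess_le (segment_ball ld tl).
have := taylor_line f_C2 l0 hq; rewrite /tau; lra.
Qed.

Lemma cubic_growth (l : R) : 0 <= l -> l * enorm d < r / 2 ->
  f (x + l *: d) - f x <= - l * tau + dot d (hess f x *m d) / 2 * l ^+ 2
    + L / 6 * (l * enorm d) ^+ 3.
Proof.
move=> l0 ld.
have hq t : 0 <= t <= l -> dot d (hess f (x + t *: d) *m d) <=
    dot d (hess f x *m d) + L * enorm d ^+ 3 * t.
  move=> tl; rewrite -lerBlDl -dotBr -mulmxBl; apply: le_trans (dot_le _ _) _.
  have := hess_lip d (segment_ball ld tl) x_ball.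
  rewrite [x + _]addrC addrK enormZ ger0_norm; last by case/andP: tl.
  move=> /(ler_wpM2l (enorm_ge0 d)); lra.
have := taylor_line f_C2 l0 hq; rewrite /tau; lra.
Qed.

(** A trial step leaving the ball is at least as long as a multiple of the
    bounded gradient. *)
Lemma long_step (rho l' : R) : 0 < rho -> r / 2 <= l' * enorm d ->
  rho * r / (2 * G) * g <= rho * l' * enorm d.
Proof.
move=> rho0 ld; have gG : g <= G := grad_le x_ball.
apply: (@le_trans _ _ (rho * (r / 2))); last by rewrite -mulrA ler_pM2l.
have -> : rho * r / (2 * G) * g = rho * (r / 2) * (g / G).
  by field; rewrite gt_eqF.
by rewrite ler_piMr ?ler_pdivrMr ?mul1r // mulr_ge0 ?ltW // divr_gt0.
Qed.

Variables (rho sigma s : R).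
Hypotheses (rho01 : 0 < rho < 1) (sigma01 : 0 < sigma < 1) (s_gt0 : 0 < s).

(** Along the gradient, the second-order term alone limits backtracking, so
    the step is either the initial one or comparable to the gradient. *)
Lemma collinear_step (l be : R) : backtracking f rho sigma s x d l ->
  d = - be *: grad f x -> 0 < be ->
  sigma * g * (l * enorm d) <= f x - f (x + l *: d) /\
  Num.min (s * be) (Num.min (rho * r / (2 * G)) (2 * rho * (1 - sigma) / M)) * g
    <= l * enorm d.
Proof.
move=> /(backtrackingP rho01 s_gt0)[/andP[l0 ls] arm l_or] dE be0.
have /andP[rho0 rho1] := rho01; have /andP[sigma0 sigma1] := sigma01.
have g0 : 0 <= g by exact: enorm_ge0.
have nd : enorm d = be * g by rewrite dE enormZ normrN gtr0_norm.
have dg : dot d (grad f x) = - (enorm d * g).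
  by rewrite nd dE dotZl -enorm_sqr /g; lra.
split.
  by move: arm; rewrite /armijo dg; lra.
set c := Num.min _ _.
have c1 : c <= s * be by rewrite /c ge_min lexx.
have c2 : c <= rho * r / (2 * G) by rewrite /c !ge_min lexx !orbT.
have c3 : c <= 2 * rho * (1 - sigma) / M by rewrite /c !ge_min lexx !orbT.
case: l_or => [->|[l' lE [l'0 nC]]].
  by rewrite nd mulrA ler_wpM2r.
have [ld|ld] := leP (r / 2) (l' * enorm d).
  by rewrite lE; apply: le_trans (long_step rho0 ld); rewrite ler_wpM2r.
have := quadratic_growth (ltW l'0) ld.
move/negP: nC; rewrite -ltNge /tau dg => h1 h2.
have d0 : 0 < enorm d.
  rewrite lt_def enorm_ge0 andbT; apply/eqP => d0.
  by move: h1 h2; rewrite d0 !mulr0 mul0r; lra.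
have pd : 0 < l' * enorm d by rewrite mulr_gt0.
have M0 : 0 < M by apply: lt_le_trans M_ge1.
have h : (1 - sigma) * g <= M / 2 * (l' * enorm d).
  rewrite -(ler_pM2l pd); lra.
apply: (@le_trans _ _ (2 * rho * (1 - sigma) / M * g)); first by rewrite ler_wpM2r.
rewrite lE -(ler_pM2l M0).
have -> : M * (2 * rho * (1 - sigma) / M * g) = 2 * rho * ((1 - sigma) * g).
  by field; rewrite gt_eqF.
have := ler_wpM2l (ltW rho0) h; lra.
Qed.

(** The term [- zt |d|^2] in the curvature bound makes Armijo's condition hold
    for every [l <= 1 - sigma] such that [l |d|] is below a multiple of [zt],
    so a shorter step is never produced. *)
Lemma newton_step (l zt mu cz : R) : backtracking f rho sigma s x d l ->
  0 < tau -> mu * enorm d ^+ 2 <= tau -> 0 <= mu ->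
  dot d (hess f x *m d) <= tau - zt * enorm d ^+ 2 -> cz * g <= zt ->
  g <= M * enorm d ->
  sigma / s * mu * (l * enorm d) ^+ 2 <= f x - f (x + l *: d) /\
  Num.min (Num.min (s / M) (rho * r / (2 * G)))
    (Num.min (rho * (1 - sigma) / M) (rho * 3 * cz / L)) * g <= l * enorm d.
Proof.
move=> /(backtrackingP rho01 s_gt0)[/andP[l0 ls] arm l_or] tau0 mutau mu0 dHd czg gM.
have /andP[rho0 rho1] := rho01; have /andP[sigma0 sigma1] := sigma01.
have g0 : 0 <= g by exact: enorm_ge0.
have M0 : 0 < M by apply: lt_le_trans M_ge1.
have gM' : g / M <= enorm d by rewrite ler_pdivrMr // mulrC.
have d_ge0 : 0 <= enorm d by exact: enorm_ge0.
split.
  have h1 : sigma * l * (mu * enorm d ^+ 2) <= sigma * l * tau.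
    by rewrite ler_wpM2l // mulr_ge0 // ltW.
  have h2 : sigma / s * mu * (l * enorm d) ^+ 2 <= sigma * l * (mu * enorm d ^+ 2).
    have -> : sigma / s * mu * (l * enorm d) ^+ 2
        = sigma * l * (mu * enorm d ^+ 2) * (l / s) by field; rewrite gt_eqF.
    rewrite ler_piMr ?ler_pdivrMr ?mul1r //.
    by rewrite !mulr_ge0 ?sqr_ge0 // ltW.
  apply: le_trans h2 _; apply: le_trans h1 _.
  by move: arm; rewrite /armijo /tau; lra.
set c := Num.min _ _.
have c1 : c <= s / M by rewrite /c !ge_min lexx.
have c2 : c <= rho * r / (2 * G) by rewrite /c !ge_min lexx !orbT.
have c3 : c <= rho * (1 - sigma) / M by rewrite /c !ge_min lexx !orbT.
have c4 : c <= rho * 3 * cz / L by rewrite /c !ge_min lexx !orbT.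
case: l_or => [->|[l' lE [l'0 nC]]].
  apply: (@le_trans _ _ (s / M * g)); first by rewrite ler_wpM2r.
  by rewrite -mulrA ler_pM2l // mulrC.
have [ld|ld] := leP (r / 2) (l' * enorm d).
  by rewrite lE; apply: le_trans (long_step rho0 ld); rewrite ler_wpM2r.
(* below this threshold, the second-order contribution [l'^2 tau / 2] of [tau]
   is absorbed by the slack [(1 - sigma) l' tau] of Armijo's condition *)
have [l's|l's] := leP (1 - sigma) l'.
  apply: (@le_trans _ _ (rho * (1 - sigma) / M * g)); first by rewrite ler_wpM2r.
  have -> : rho * (1 - sigma) / M * g = rho * (1 - sigma) * (g / M) by lra.
  rewrite lE; apply: ler_pM => //; first by rewrite mulr_ge0 ?ltW // subr_gt0.
    by rewrite divr_ge0 // ltW.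
  by rewrite ler_pM2l.
have := cubic_growth (ltW l'0) ld.
move/negP: nC; rewrite -ltNge => h1 h2.
have d0 : 0 < enorm d.
  rewrite lt_def enorm_ge0 andbT; apply/eqP => /enorm_eq0 d0.
  by move: tau0; rewrite /tau d0 dot0l oppr0 ltxx.
have pd : 0 < (l' * enorm d) ^+ 2 by rewrite exprn_gt0 // mulr_gt0.
have h3 : l' ^+ 2 * dot d (hess f x *m d) <= l' ^+ 2 * (tau - zt * enorm d ^+ 2).
  by rewrite ler_wpM2l // sqr_ge0.
have h4 : l' * tau * l' <= l' * tau * (1 - sigma).
  by rewrite ler_wpM2l ?(ltW l's) // mulr_ge0 // ltW.
have h5 : 0 <= l' * tau * (1 - sigma).
  by rewrite !mulr_ge0 ?subr_ge0 ?ltW.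
have h6 : 3 * zt <= L * (l' * enorm d).
  rewrite -(ler_pM2l pd); move: h1 h2; rewrite /tau in h3 h4 h5 *; lra.
apply: (@le_trans _ _ (rho * 3 * cz / L * g)); first by rewrite ler_wpM2r.
rewrite lE -(ler_pM2l L_gt0).
have -> : L * (rho * 3 * cz / L * g) = rho * (3 * (cz * g)).
  by field; rewrite gt_eqF.
have := ler_wpM2l (ltW rho0) h6; have := ler_wpM2l (ltW rho0) czg; lra.
Qed.

(** The negative curvature term dominates the cubic remainder as long as
    [l |d|] is below a multiple of [zt]. The bounds hold for the long steps of
    the forward linesearch as well. *)
Lemma curvature_step (l zt cz : R) :
  curvature_linesearch f rho sigma s (hess f x) x d l ->
  0 < tau -> enorm d = g -> 0 < g -> 0 <= zt ->
  dot d (hess f x *m d) <= - zt * enorm d ^+ 2 -> cz * g <= zt ->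
  sigma / 2 * zt * (l * enorm d) ^+ 2 <= f x - f (x + l *: d) /\
  Num.min s (Num.min (rho * r / (2 * G)) (rho * 3 * (1 - sigma) * cz / L)) * g
    <= l * enorm d.
Proof.
move=> /(curvature_linesearchP rho01 s_gt0)[l0 arm l_or] tau0 nd gp zt0 dHd czg.
have /andP[rho0 rho1] := rho01; have /andP[sigma0 sigma1] := sigma01.
have g0 := ltW gp.
split.
  have h1 : l ^+ 2 * dot d (hess f x *m d) <= l ^+ 2 * (- zt * enorm d ^+ 2).
    by rewrite ler_wpM2l // sqr_ge0.
  have h2 : 0 <= sigma * l * tau by rewrite !mulr_ge0 // ltW.
  have := ler_wpM2l (ltW sigma0) h1.
  by move: arm h2; rewrite /curvature_armijo /tau (dotC (grad f x)); lra.
set c := Num.min _ _.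
have c1 : c <= s by rewrite /c !ge_min lexx.
have c2 : c <= rho * r / (2 * G) by rewrite /c !ge_min lexx !orbT.
have c3 : c <= rho * 3 * (1 - sigma) * cz / L by rewrite /c !ge_min lexx !orbT.
case: l_or => [sl|[l' lE [l'0 nC]]].
  by rewrite nd ler_wpM2r // (le_trans c1).
have [ld|ld] := leP (r / 2) (l' * enorm d).
  by rewrite lE; apply: le_trans (long_step rho0 ld); rewrite ler_wpM2r.
have := cubic_growth (ltW l'0) ld.
move/negP: nC; rewrite -ltNge (dotC (grad f x)) => h1 h2.
have pd : 0 < (l' * enorm d) ^+ 2 by rewrite exprn_gt0 // mulr_gt0 // nd.
have h3 : l' ^+ 2 * dot d (hess f x *m d) <= l' ^+ 2 * (- zt * enorm d ^+ 2).
  by rewrite ler_wpM2l // sqr_ge0.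
have sg : 0 <= 1 - sigma by rewrite subr_ge0 ltW.
have h4 := ler_wpM2l sg h3.
have h5 : 0 <= l' * tau * (1 - sigma) by rewrite mulr_ge0 ?mulr_ge0 // ltW.
have h6 : 3 * ((1 - sigma) * zt) <= L * (l' * enorm d).
  rewrite -(ler_pM2l pd); move: h1 h2; rewrite /tau in h5 *; lra.
apply: (@le_trans _ _ (rho * 3 * (1 - sigma) * cz / L * g)); first by rewrite ler_wpM2r.
rewrite lE -(ler_pM2l L_gt0).
have -> : L * (rho * 3 * (1 - sigma) * cz / L * g) = rho * (3 * ((1 - sigma) * (cz * g))).
  by field; rewrite gt_eqF.
have := ler_wpM2l (ltW rho0) h6.
have := ler_wpM2l (ltW rho0) (ler_wpM2l sg czg); lra.
Qed.

End StepProgress.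

(** * Progress of one iteration *)

Section MethodStep.
Context {R : realType} {n : nat}.
Variables (f : 'cV[R]_n -> R) (xs : 'cV[R]_n) (r M L G Zc cz : R).
Hypothesis f_C2 : twice_continuously_differentiable f.
Hypotheses (r_gt0 : 0 < r) (M_ge1 : 1 <= M) (L_gt0 : 0 < L) (G_gt0 : 0 < G).
Hypotheses (Zc_ge0 : 0 <= Zc) (cz_gt0 : 0 < cz).
Hypothesis hess_le : forall y u : 'cV[R]_n, enorm (y - xs) < r ->
  enorm (hess f y *m u) <= M * enorm u.
Hypothesis hess_lip : forall y y' u : 'cV[R]_n,
  enorm (y - xs) < r -> enorm (y' - xs) < r ->
  enorm ((hess f y - hess f y') *m u) <= L * enorm (y - y') * enorm u.
Hypothesis grad_le : forall y : 'cV[R]_n, enorm (y - xs) < r ->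
  enorm (grad f y) <= G.
Variables (rho sigma alpha Acap s : R).
Hypotheses (rho01 : 0 < rho < 1) (sigma01 : 0 < sigma < 1) (s_gt0 : 0 < s).
Hypothesis Acap01 : 0 < Acap <= 1.

(** The constant depends only on bounds for [f] near [xs] and on the parameters
    of the method; in particular it is uniform in [theta] and [a]. *)
Lemma step_progress : exists2 c, 0 < c &
  forall (x x' : 'cV[R]_n) (theta a zt : R),
  enorm (x - xs) < r / 2 -> grad f x != 0 -> (hess f x)^T = hess f x ->
  0 <= theta -> 0 < a -> zt <= Zc -> cz * enorm (grad f x) <= zt ->
  iteration f rho sigma alpha Acap s theta a zt (hess f x) x x' ->
  sufficient_progress c (Num.min Acap (a * enorm (grad f x) `^ alpha)) zt
    (enorm (grad f x)) (enorm (x' - x)) (f x - f x').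
Proof.
have /andP[rho0 rho1] := rho01; have /andP[sigma0 sigma1] := sigma01.
have /andP[A0 A1] := Acap01.
pose M' := M + Zc.
have M'_ge1 : 1 <= M' by rewrite /M' -[1]addr0 lerD.
have M'0 : 0 < M' by apply: lt_le_trans M'_ge1.
have hess_le' (y u : 'cV[R]_n) : enorm (y - xs) < r ->
    enorm (hess f y *m u) <= M' * enorm u.
  move=> yr; apply: le_trans (hess_le u yr) _.
  by rewrite ler_wpM2r ?enorm_ge0 // lerDl.
have sg : 0 < 1 - sigma by rewrite subr_gt0.
have pm (u v : R) : 0 < u -> 0 < v -> 0 < Num.min u v.
  by move=> u0 v0; rewrite lt_min u0 v0.
pose c1 := Num.min (s / M' ^+ 2)
  (Num.min (rho * r / (2 * G)) (2 * rho * (1 - sigma) / M')).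
pose c2 := Num.min (Num.min (s / M') (rho * r / (2 * G)))
    (Num.min (rho * (1 - sigma) / M') (rho * 3 * cz / L)).
pose c3 := Num.min s
  (Num.min (rho * r / (2 * G)) (rho * 3 * (1 - sigma) * cz / L)).
have c1_gt0 : 0 < c1.
  by rewrite /c1 !lt_min !divr_gt0 ?mulr_gt0 // ?exprn_gt0.
have c2_gt0 : 0 < c2 by rewrite /c2 !lt_min !divr_gt0 ?mulr_gt0.
have c3_gt0 : 0 < c3 by rewrite /c3 !lt_min s_gt0 !divr_gt0 ?mulr_gt0.
exists (Num.min (Num.min (Num.min sigma c1) (Num.min (sigma / s) c2))
  (Num.min (sigma / 2) c3)).
  exact: pm _ _ (pm _ _ (pm _ _ sigma0 c1_gt0)
    (pm _ _ (divr_gt0 sigma0 s_gt0) c2_gt0))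
    (pm _ _ (divr_gt0 sigma0 (ltr0Sn _ 1)) c3_gt0).
move=> x x' theta a zt x_near gn0 H_sym theta0 a0 ztZ czg.
set g := enorm (grad f x); set mu := Num.min Acap _.
have g0 : 0 < g by exact: enorm_gt0.
have zt0 : 0 <= zt by apply: le_trans czg; rewrite mulr_ge0 // ltW.
have mu0 : 0 < mu by rewrite /mu lt_min A0 mulr_gt0 ?powR_gt0.
have mu1 : mu <= 1 by rewrite /mu ge_min A1.
move=> [d [fl [l [dir step ->]]]].
have -> : x + l *: d - x = l *: d by rewrite addrC addKr.
rewrite enormZ.
have xr := x_ball r_gt0 x_near.
set A := hess f x + zt%:M in dir *.
have A_sym : A^T = A by rewrite /A raddfD /= H_sym tr_scalar_mx.
have AE u : dot u (A *m u) = dot u (hess f x *m u) + zt * enorm u ^+ 2.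
  by rewrite /A mulmxDl dotDr mul_scalar_mx dotZr enorm_sqr.
have A_le (u : 'cV[R]_n) : enorm (A *m u) <= M' * enorm u.
  rewrite /A mulmxDl mul_scalar_mx; apply: le_trans (enormD _ _) _.
  rewrite enormZ ger0_norm // /M' mulrDl lerD ?hess_le //.
  by rewrite ler_wpM2r ?enorm_ge0.
have b0 : - grad f x != 0 by rewrite oppr_eq0.
have weaken c : Num.min (Num.min (Num.min sigma c1) (Num.min (sigma / s) c2))
    (Num.min (sigma / 2) c3) <= c ->
    sufficient_progress c mu zt g (`|l| * enorm d) (f x - f (x + l *: d)) ->
    sufficient_progress (Num.min (Num.min (Num.min sigma c1) (Num.min (sigma / s) c2))
    (Num.min (sigma / 2) c3)) mu zt g (`|l| * enorm d) (f x - f (x + l *: d)).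
  move=> cc; apply: sufficient_progress_le => //; try exact: ltW.
  by rewrite mulr_ge0 ?enorm_ge0.
(* the hypothesis on [be] makes the step factor [s * be] at least [c1 * mu] *)
have collinear be : backtracking f rho sigma s x d l -> d = - be *: grad f x ->
    0 < be -> mu <= M' ^+ 2 * be ->
    sufficient_progress (Num.min sigma c1) mu zt g (`|l| * enorm d)
      (f x - f (x + l *: d)).
  move=> bt dE be0 mube; have [/andP[l0 _] _ _] := backtrackingP rho01 s_gt0 bt.
  have [D st] := collinear_step f_C2 r_gt0 M'_ge1 G_gt0 hess_le' grad_le
    x_near rho01 sigma01 s_gt0 bt dE be0.
  left; rewrite gtr0_norm //; split.
    apply: le_trans D; rewrite -!mulrA ler_wpM2r ?ge_min ?lexx //.
    by rewrite !mulr_ge0 ?enorm_ge0 // ltW.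
  apply: le_trans st; rewrite ler_wpM2r ?(ltW g0) //.
  have c1s : c1 * mu <= s * be.
    apply: (@le_trans _ _ (s / M' ^+ 2 * mu)).
      by rewrite ler_wpM2r ?(ltW mu0) // ge_min lexx.
    by rewrite -mulrA ler_pM2l // ler_pdivrMl ?exprn_gt0.
  have c1mu : c1 * mu <= c1 by rewrite ler_piMr // ltW.
  apply: (@le_trans _ _ (c1 * mu)).
    by rewrite ler_wpM2r ?(ltW mu0) // ge_min lexx orbT.
  by rewrite le_min c1s (le_trans c1mu) // /c1 ge_min lexx orbT.
case: dir => d0 [fl0 [mr [[[flE small] [dE flE']]|[nreset [dE flE]]]]].
  (* the reset is the collinear case with factor 1, as [mu <= Acap <= 1] *)
  apply: (weaken (Num.min sigma c1)); first by rewrite ge_min ge_min lexx.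
  apply: (collinear 1) => //; first by move: step; rewrite flE'.
    by rewrite dE scaleN1r.
  by rewrite mulr1 (le_trans mu1) // exprn_ege1.
subst d0 fl0; case: fl mr step nreset => [mr bt nreset|mr ls _|/minres_GDP//].
  have [tau0 tauA t_cases] := minres_SOLP A_sym b0 A_le mr.
  have [/andP[l0 _] _ _] := backtrackingP rho01 s_gt0 bt.
  have curv : mu * enorm d ^+ 2 <= dot d (A *m d).
    by rewrite leNgt; apply/negP => h; apply: nreset; split.
  case: t_cases => [[be [be0 dE beE]]|gd].
    apply: (weaken (Num.min sigma c1)); first by rewrite ge_min ge_min lexx.
    apply: (collinear be) => //; first by rewrite dE scalerN scaleNr.
    (* [be |A g|^2 = dot g (A g) >= mu |g|^2], while [|A g| <= M' |g|] *)
    have gg : 0 < be ^+ 2 * g ^+ 2 by rewrite mulr_gt0 ?exprn_gt0.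
    have AbM : dot (A *m - grad f x) (A *m - grad f x) <= M' ^+ 2 * g ^+ 2.
      rewrite -enorm_sqr -exprMn ler_pXn2r ?nnegrE ?enorm_ge0 //; last first.
        by rewrite mulr_ge0 // ltW.
      by rewrite /g -(enormN (grad f x)).
    have nd : enorm d ^+ 2 = be ^+ 2 * g ^+ 2.
      by rewrite dE enormZ enormN exprMn real_normK ?num_real.
    have dAd : dot d (A *m d) = be ^+ 2 * (be * dot (A *m - grad f x) (A *m - grad f x)).
      by rewrite beE dE -scalemxAr dotZl dotZr mulrA expr2.
    rewrite -(ler_pM2r gg) -nd; apply: le_trans curv _.
    rewrite dAd nd.
    have := ler_wpM2l (ltW be0) AbM; move/(ler_wpM2l (sqr_ge0 be)); lra.
  apply: (weaken (Num.min (sigma / s) c2)).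
    by rewrite ge_min ge_min lexx orbT.
  have gM : g <= M' * enorm d.
    have : g * g <= M' * (enorm d * g).
      have := dot_le d (- grad f x); rewrite enormN -/g => h.
      move: gd; rewrite -enorm_sqr enormN -/g expr2 => gd; apply: le_trans gd _.
      by rewrite ler_wpM2l // ltW.
    by rewrite mulrA ler_pM2r.
  have tauE : dot d (- grad f x) = - dot d (grad f x) by rewrite dotNr.
  rewrite tauE in tau0 tauA; rewrite AE in tauA.
  have h1 : mu * enorm d ^+ 2 <= - dot d (grad f x).
    by apply: le_trans curv _; rewrite AE.
  have h2 : dot d (hess f x *m d) <= - dot d (grad f x) - zt * enorm d ^+ 2.
    by rewrite lerBrDr.
  have [D st] := newton_step f_C2 r_gt0 M'_ge1 L_gt0 G_gt0 hess_lip
    grad_le x_near rho01 sigma01 s_gt0 bt tau0 h1 (ltW mu0) h2 czg gM.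
  right; exists mu; first by left.
  rewrite gtr0_norm //; split.
    apply: le_trans D; rewrite -[leLHS]mulrA -[leRHS]mulrA ler_wpM2r // ?ge_min ?lexx //.
    by rewrite mulr_ge0 ?sqr_ge0 // ltW.
  by apply: le_trans st; rewrite ler_wpM2r ?(ltW g0) // ge_min lexx orbT.
have [nd tau0 curv] := minres_NPCP b0 theta0 mr.
have [l0 _ _] := curvature_linesearchP rho01 s_gt0 ls.
rewrite enormN in nd; rewrite dotNr in tau0.
have h : dot d (hess f x *m d) <= - zt * enorm d ^+ 2.
  by move: curv; rewrite AE; lra.
have [D st] := curvature_step f_C2 r_gt0 L_gt0 G_gt0 hess_lip grad_le
  x_near rho01 sigma01 s_gt0 ls tau0 nd g0 zt0 h czg.
apply: (weaken (Num.min (sigma / 2) c3)); first by rewrite ge_min lexx orbT.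
right; exists zt; first by right.
rewrite gtr0_norm //; split.
  apply: le_trans D; rewrite -[leLHS]mulrA -[leRHS]mulrA ler_wpM2r // ?ge_min ?lexx //.
  by rewrite mulr_ge0 ?sqr_ge0.
by apply: le_trans st; rewrite ler_wpM2r ?(ltW g0) // ge_min lexx orbT.
Qed.

End MethodStep.

(** * Scalar inequalities and desingularizing functions *)

Section ScalarTools.
Context {R : realType}.
Implicit Types (y w e : R).

Lemma powR_interpolation y w e (m : R) : 0 <= y <= m -> 0 <= w <= m -> 0 < m ->
  0 <= e <= 1 -> y `^ (1 - e) * w `^ e <= m.
Proof.
move=> /andP[y0 ym] /andP[w0 wm] m0 /andP[e0 e1].
have e1' : 0 <= 1 - e by rewrite subr_ge0.
apply: (@le_trans _ _ (m `^ (1 - e) * m `^ e)).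
  rewrite ler_pM ?powR_ge0 // ge0_ler_powR ?nnegrE // ltW //.
by rewrite -powRD ?(gt_eqF m0) ?implybT // subrK powRr1 // ltW.
Qed.

(** A step [st] at least as long as a multiple of the gradient norm [y] whose
    squared length is controlled with a weight [nu] vanishing like [y `^ e] is
    still linearly controlled, up to the summable term [w `^ (- (1 / e))]: the
    weighted bound reads [c st^2 <= De y^(1-e) (w^(-1/e))^e]. The constant adds
    those obtained for each value of the minimum [nu]. *)
Lemma weighted_step_le (c N w e y st De nu : R) : 0 < c <= 1 -> 0 < N -> 0 < w ->
  0 < e <= 1 -> 0 < y -> 0 <= De -> nu = Num.min N (w * y `^ e) ->
  c * nu * st ^+ 2 <= y * De -> c * y <= st ->
  st <= (c ^- 2 + (c ^+ 2 * N)^-1) * (De + w `^ (- (1 / e))).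
Proof.
move=> /andP[c0 c1] N0 w0 /andP[e0 e1] y0 De0 nuE h cy.
set om := w `^ _.
have om0 : 0 < om by rewrite powR_gt0.
have st0 : 0 < st by apply: lt_le_trans cy; rewrite mulr_gt0.
have yst : y <= st / c by rewrite ler_pdivlMr // mulrC.
have c20 : 0 < c ^+ 2 by rewrite exprn_gt0.
have k1 : 0 < c ^- 2 by rewrite invr_gt0.
have k2 : 0 < (c ^+ 2 * N)^-1 by rewrite invr_gt0 mulr_gt0.
have S0 : 0 < De + om by rewrite ltr_wpDl.
have scale t : 0 < t -> t * st <= De + om -> st <= t^-1 * (De + om).
  by move=> t0 tst; rewrite ler_pdivlMl.
suff [h1|h1] : c ^+ 2 * N * st <= De + om \/ c ^+ 2 * st <= De + om.
- apply: le_trans (scale _ _ h1) _; first by rewrite mulr_gt0.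
  by rewrite ler_wpM2r ?(ltW S0) // lerDr ltW.
- apply: le_trans (scale _ c20 h1) _.
  by rewrite ler_wpM2r ?(ltW S0) // lerDl ltW.
have yDe : y * De <= st / c * De by rewrite ler_wpM2r.
have [Nw|/ltW Nw] := lerP N (w * y `^ e); move: h; rewrite nuE.
  rewrite min_l // => h.
  left; apply: (@le_trans _ _ De); last by rewrite lerDl ltW.
  have : c * N * st ^+ 2 <= st / c * De by apply: le_trans h yDe.
  rewrite -(ler_pM2l c0) -(ler_pM2l st0) => h'.
  rewrite -(ler_pM2l st0) -(ler_pM2l st0).
  move: h'; have -> : st * (c * (st / c * De)) = st * (st * De).
    by field; rewrite gt_eqF.
  lra.
rewrite min_r // => h; right.
have wom : w * om `^ e = 1.
  rewrite /om -powRrM mulNr mul1r mulVf ?gt_eqF // powR_inv1 ?(ltW w0) //.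
  by rewrite divff ?gt_eqF.
have yE : y = y `^ e * y `^ (1 - e).
  by rewrite -powRD ?(gt_eqF y0) ?implybT // addrC subrK powRr1 // ltW.
have ye0 : 0 < y `^ e by rewrite powR_gt0.
have ome0 : 0 < om `^ e by rewrite powR_gt0.
have h2 : c * st ^+ 2 <= De * (y `^ (1 - e) * om `^ e).
  rewrite -(ler_pM2l ye0); have := ler_wpM2r (ltW ome0) h.
  have -> : c * (w * y `^ e) * st ^+ 2 * om `^ e
     = y `^ e * (c * st ^+ 2) * (w * om `^ e) by ring.
  rewrite wom mulr1 [X in _ <= X * De * _]yE; lra.
have cc : c ^+ 2 <= c by rewrite expr2 ler_piMr // ltW.
have [yom|yom] := leP y om.
  have h3 : y `^ (1 - e) * om `^ e <= om.
    by apply: powR_interpolation; rewrite ?lexx ?yom ?e1 ?ltW ?e0 //.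
  have h4 : c * st ^+ 2 <= De * om.
    by apply: le_trans h2 _; rewrite ler_wpM2l.
  have X0 : 0 <= c ^+ 2 * st by rewrite ltW // mulr_gt0.
  rewrite -(ler_pXn2r (ltn0Sn 1)) ?nnegrE ?(ltW S0) // exprMn.
  have c4 : (c ^+ 2) ^+ 2 <= c.
    apply: le_trans cc; rewrite -[leRHS]mulr1 expr2 ler_wpM2l ?(ltW c20) //.
    by rewrite exprn_ile1 // ltW.
  have := ler_wpM2r (sqr_ge0 st) c4.
  have := mulr_ge0 De0 (ltW om0); have := sqr_ge0 De; have := sqr_ge0 om.
  lra.
have h3 : y `^ (1 - e) * om `^ e <= y.
  by apply: powR_interpolation; rewrite ?lexx ?e1 ?ltW ?e0 //.
have h4 : c * st ^+ 2 <= De * y by apply: le_trans h2 _; rewrite ler_wpM2l.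
apply: (@le_trans _ _ De); last by rewrite lerDl ltW.
rewrite -(ler_pM2l st0).
have : c * (c * st ^+ 2) <= c * (st / c * De).
  by rewrite ler_pM2l // (le_trans h4) // mulrC.
have -> : c * (st / c * De) = st * De by field; rewrite gt_eqF.
lra.
Qed.

(** [E] is the tail of the series; the finite term of index 0 is added to the
    sum first. *)
Lemma summable_tails (u : nat -> R) : (forall k, 0 <= u k) ->
  (\sum_(1 <= k <oo) (u k)%:E < +oo)%E ->
  exists E : nat -> R, [/\ forall k, 0 <= E k,
    forall k, u k = E k - E k.+1 &
    forall eps, 0 < eps -> exists N, forall k, (N <= k)%N -> E k < eps].
Proof.
move=> u0 sum1; pose T k := (\sum_(k <= i <oo) (u i)%:E)%E.
have u0E k : (0 <= (u k)%:E)%E by rewrite lee_fin.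
have T0 k : (0 <= T k)%E by apply: nneseries_ge0 => i _.
have TS k : T k = ((u k)%:E + T k.+1)%E.
  by rewrite /T (nneseries_split k 1) // addn1 big_nat1.
have Tfin0 : (T 0%N < +oo)%E by rewrite TS lte_add_pinfty // ltry.
have Tfin k : T k \is a fin_num.
  rewrite ge0_fin_numE //; elim: k => // k; apply: le_lt_trans.
  by rewrite [leRHS]TS leeDr.
exists (fun k => fine (T k)); split=> [k|k|eps eps0].
- exact: fine_ge0.
- by rewrite TS fineD //= addrK.
have tail := nneseries_tail_cvg (P := xpredT) Tfin0 (fun k _ => u0E k).
have /fine_cvgP[_ /cvgrPdist_lt /(_ _ eps0)[N _ HN]] := tail.
exists N => k Nk; have := HN k Nk; rewrite /= sub0r normrN.
by move=> h; apply: le_lt_trans h; exact: ler_norm.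
Qed.

(** The chord inequality from [c] to [b], divided by the step and passed to the
    limit at [c]. *)
Lemma concave_gradient_le (eta : \bar R) (phi : R -> R) (b c : R) :
  desingularizing eta phi -> 0 <= b -> 0 < c ->
  (b%:E < eta)%E -> (c%:E < eta)%E ->
  derive1 phi c * (c - b) <= phi c - phi b.
Proof.
move=> [_ cvx der _ _] b0 c0 beta ceta.
have [dphi _] := der c c0 ceta.
have dif : differentiable phi c by apply/derivable1_diffP.
have dphi' : derivable phi c (b - c) := diff_derivable dif.
have DE : 'D_(b - c) phi c = (b - c) * derive1 phi c.
  rewrite deriveE // -[b - c]mulr1 -[X in 'd _ _ X]/((b - c) *: (1 : R)) linearZ.
  by rewrite derive1E deriveE // mulr1.
suff : phi b - phi c <= 'D_(b - c) phi c by rewrite DE; lra.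
have lim_r : (fun h => h^-1 *: ((phi \o shift c) (h *: (b - c)) - phi c))
    @ 0^'+ --> 'D_(b - c) phi c by apply: cvg_dnbhs_at_right; exact: dphi'.
rewrite -(cvg_lim _ lim_r) //; apply: limr_ge.
  by apply/cvg_ex; eexists; exact: lim_r.
near=> h.
have h0 : 0 < h by near: h; exact: nbhs_right_gt.
have h1 : h < 1 by near: h; apply: nbhs_right_lt.
rewrite /GRing.scale /= ler_pdivlMl //.
have bD : b \in [set t : R | 0 <= t /\ (t%:E < eta)%E] by rewrite inE.
have cD : c \in [set t : R | 0 <= t /\ (t%:E < eta)%E].
  by rewrite inE /=; split; [exact: ltW|].
have : - phi (h * (b - c) + c) <= h * - phi b + (1 - h) * - phi c.
  have -> : h * (b - c) + c = h * b + (1 - h) * c by ring.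
  exact: cvx (Itv01 (ltW h0) (ltW h1)) b c bD cD.
lra.
Unshelve. all: by end_near.
Qed.

Lemma desingularizing_near0 (eta : \bar R) (phi : R -> R) (eps : R) :
  desingularizing eta phi -> (0 < eta)%E -> 0 < eps ->
  exists2 del, 0 < del &
    forall t, 0 <= t -> (t%:E < eta)%E -> t < del -> phi t < eps.
Proof.
move=> [[cphi _] _ _ phi0 _] eta0 eps0.
pose D := [set t : R | 0 <= t /\ (t%:E < eta)%E].
have D0 : D 0 by split.
have c0 : phi t @[t --> nbhs_subspace (0 : subspace D)] --> phi 0 := cphi 0.
rewrite -(nbhs_subspace_in D0) in c0.
have nb : nbhs (phi 0) [set v : R | v < eps].
  by rewrite phi0; exact: lt_nbhsl.
have := c0 _ nb; rewrite /= => /nbhs_ballP[del /= del0 Hdel].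
exists del => // t t0 teta tdel; apply: Hdel => //.
by rewrite /ball /= sub0r normrN ger0_norm.
Qed.

End ScalarTools.

(** * Accumulation points, descent and local bounds *)

Section Convergence.
Context {R : realType} {n : nat}.
Implicit Types (f : 'cV[R]_n -> R) (x : nat -> 'cV[R]_n) (xs : 'cV[R]_n).

Lemma accumulation_pointsP x xs : accumulation_points x xs ->
  forall (eps : R) N, 0 < eps -> exists2 k, (N <= k)%N & enorm (x k - xs) < eps.
Proof.
move=> acc eps N eps0; set u := fun k => (enorm (x k - xs))%:E.
have accE : limn_einf u = 0%:E := acc.
have uN : (einfs u N <= 0%:E)%E.
  rewrite -accE limn_einf_lim (cvg_lim _ (@cvg_einfs_sup _ u)) //.
  by apply: ereal_sup_ubound; exists N.
have : (ereal_inf (sdrop u N) < eps%:E)%E by apply: le_lt_trans uN _; rewrite lte_fin.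
by move=> /ereal_inf_lt[_ /= [k Nk <-]]; rewrite lte_fin => h; exists k.
Qed.

(** If close to [xs] every step is bounded by the decrease of a potential
    tending to [0], then an iterate close to [xs] with a small potential traps
    the sequence: the distance to [xs] plus the potential cannot increase. *)
Lemma potential_convergence x xs (r : R) (Psi : nat -> R) k1 : 0 < r ->
  (forall eps N, 0 < eps -> exists2 k, (N <= k)%N & enorm (x k - xs) < eps) ->
  (forall k, (k1 <= k)%N -> 0 <= Psi k) ->
  (forall eps, 0 < eps -> exists N, forall k, (N <= k)%N -> Psi k < eps) ->
  (forall k, (k1 <= k)%N -> enorm (x k - xs) < r ->
    enorm (x k.+1 - x k) <= Psi k - Psi k.+1) ->
  forall eps, 0 < eps -> exists N, forall k, (N <= k)%N -> enorm (x k - xs) < eps.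
Proof.
move=> r0 acc Psi0 Psi_cvg step eps eps0; pose e := Num.min eps r.
have e0 : 0 < e by rewrite lt_min eps0.
have e20 : 0 < e / 2 by rewrite divr_gt0.
have [N HN] := Psi_cvg _ e20.
have [k0 k0N k0e] := acc _ (maxn N k1) e20.
have /andP[Nk0 k1k0] : (N <= k0)%N && (k1 <= k0)%N by rewrite -geq_max.
have PsiN := HN _ Nk0.
have main j : enorm (x (k0 + j)%N - xs) + Psi (k0 + j)%N < e.
  elim: j => [|j IH]; first by rewrite addn0; lra.
  have kj : (k1 <= k0 + j)%N by rewrite (leq_trans k1k0) // leq_addr.
  have Pj := Psi0 _ kj.
  have near_j : enorm (x (k0 + j)%N - xs) < r.
    apply: (@lt_le_trans _ _ e); last by rewrite ge_min lexx orbT.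
    by apply: le_lt_trans IH; rewrite lerDl.
  have := step _ kj near_j; rewrite addnS.
  have := enorm_triangle (x (k0 + j)%N) (x (k0 + j).+1) xs; lra.
exists k0 => k k0k; have := main (k - k0)%N; rewrite subnKC // => h.
apply: (@lt_le_trans _ _ e); last by rewrite ge_min lexx.
by apply: le_lt_trans h; rewrite lerDl Psi0 // (leq_trans k1k0).
Qed.

(** Every direction has a negative product with the gradient, and those of
    nonpositive curvature for [H + zt%:M] also have it for [H]. *)
Lemma iteration_descent f (rho sigma alpha Acap s theta a zt : R)
    (H : 'M[R]_n) (x x' : 'cV[R]_n) :
  0 < rho < 1 -> 0 < sigma < 1 -> 0 < s -> 0 <= theta -> 0 <= zt -> H^T = H ->
  grad f x != 0 -> iteration f rho sigma alpha Acap s theta a zt H x x' ->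
  f x' < f x.
Proof.
move=> rho01 sigma01 s0 theta0 zt0 H_sym g0 [d [fl [l [dir step ->]]]].
have /andP[sigma0 sigma1] := sigma01.
have b0 : - grad f x != 0 by rewrite oppr_eq0.
have armijo_lt : 0 < dot d (- grad f x) -> backtracking f rho sigma s x d l ->
    f (x + l *: d) < f x.
  rewrite dotNr oppr_gt0 => tau0.
  move=> /(backtrackingP rho01 s0)[/andP[l0 _] arm _].
  rewrite -subr_lt0; apply: le_lt_trans arm _.
  by rewrite pmulr_rlt0 // mulr_gt0.
case: dir => d0 [fl0 [mr [[[flE small] [dE flE']]|[nreset [dE flE]]]]].
  by apply: armijo_lt; [rewrite dE dot_gt0 | move: step; rewrite flE'].
subst d0 fl0; case: fl mr step nreset => [mr bt _|mr ls _|/minres_GDP//].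
  have [m m0 Am] := matrix_bounded (H + zt%:M).
  have A_sym : (H + zt%:M)^T = H + zt%:M by rewrite raddfD /= H_sym tr_scalar_mx.
  by apply: armijo_lt bt; have [] := minres_SOLP A_sym b0 Am mr.
have [_ tau0 curv] := minres_NPCP b0 theta0 mr.
have [l0 arm _] := curvature_linesearchP rho01 s0 ls.
rewrite dotNr oppr_gt0 in tau0.
rewrite mulmxDl mul_scalar_mx dotDr dotZr in curv.
have curv' : dot d (H *m d) <= 0.
  by have := mulr_ge0 zt0 (dot_ge0 d); lra.
rewrite -subr_lt0; apply: le_lt_trans arm _.
rewrite (dotC (grad f x)).
have h1 : sigma * l * dot d (grad f x) < 0 by rewrite pmulr_rlt0 // mulr_gt0.
have h2 : sigma / 2 * l ^+ 2 * dot d (H *m d) <= 0.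
  by rewrite mulr_ge0_le0 // mulr_ge0 ?sqr_ge0 // divr_ge0 ?ltW.
lra.
Qed.

(** The maxima with 1 make the constants admissible in [step_progress]. *)
Lemma local_bounds f xs (VH W : set 'cV[R]_n) :
  twice_continuously_differentiable f -> (VH^°) xs ->
  locally_lipschitz_on VH (hess f) -> nbhs xs W ->
  exists r M L G : R, [/\ 0 < r, 1 <= M, 0 < L & 0 < G] /\
  forall y, enorm (y - xs) < r -> [/\ W y, enorm (grad f y) <= G,
    forall u, enorm (hess f y *m u) <= M * enorm u &
    forall y' u, enorm (y' - xs) < r ->
      enorm ((hess f y - hess f y') *m u) <= L * enorm (y - y') * enorm u].
Proof.
move=> [df dg hcont] VHxs lip Wxs.
have VHn : nbhs xs VH by [].
have [U Uxs [L0 lipL]] := lip _ (nbhs_singleton VHn).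
have gcont : {for xs, continuous (grad f)} by exact: differentiable_continuous.

have ng : \forall y \near xs, `|grad f xs - grad f y| < 1.
  by move/cvgrPdist_lt : gcont; apply.
have nh : \forall y \near xs, `|hess f xs - hess f y| < 1.
  by have /cvgrPdist_lt := hcont xs; apply.
have : nbhs xs (VH `&` U `&` W `&` [set y | `|grad f xs - grad f y| < 1]
    `&` [set y | `|hess f xs - hess f y| < 1]).
  by do ![apply: filterI => //].
move=> /nbhs_enormP[r r0 near_r].
pose m := `|hess f xs| + 1.
pose M := Num.max 1 (n.+1%:R * (n.+1%:R * m)).
pose L := Num.max 1 L0.
pose G := n.+1%:R * (`|grad f xs| + 1).
exists r, M, L, G; split.
  split=> //; rewrite ?le_max ?lt_max ?lexx ?ltr01 //.
  by rewrite mulr_gt0 // ltr_wpDl.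
move=> y yr; have [[[[Vy Uy] Wy] gy] hy] := near_r y yr; split=> //.
- apply: le_trans (enorm_le_norm _) _; rewrite ler_wpM2l //.
  have -> : grad f y = grad f xs - (grad f xs - grad f y) by rewrite opprB addrC subrK.
  by apply: le_trans (ler_normB _ _) _; rewrite lerD2l ltW.
- move=> u; apply: (@le_trans _ _ (n.+1%:R * (n.+1%:R * m) * enorm u)).
    apply: enorm_mulmx_le => i j.
    apply: (@le_trans _ _ `|hess f y|).
      rewrite [leRHS]/Num.Def.normr /= mx_normrE; apply/bigmax_geP; right => /=.
      by exists (i, j).
    have -> : hess f y = hess f xs - (hess f xs - hess f y) by rewrite opprB addrC subrK.
    by apply: le_trans (ler_normB _ _) _; rewrite lerD2l ltW.
  by rewrite ler_wpM2r ?enorm_ge0 // le_max lexx orbT.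
move=> y' u y'r; have [[[[Vy' Uy'] _] _] _] := near_r y' y'r.
apply: le_trans (specnorm_le _ _) _; rewrite ler_wpM2r ?enorm_ge0 //.
apply: le_trans (lipL _ _ (conj Vy Uy) (conj Vy' Uy')) _.
by rewrite ler_wpM2r ?enorm_ge0 // le_max lexx orbT.
Qed.

End Convergence.

(** * Convergence *)

Section ProgressConsequences.
Context {R : realType}.

(** As [e <= 1], [y <= G^(1-e) y^e] for [y <= G]. *)
Lemma regularization_ge (Zc zbar e y G w : R) : 0 < Zc -> 0 < zbar ->
  0 < e <= 1 -> 0 < G -> 0 < y <= G -> zbar <= w ->
  Num.min (Zc / G) (zbar / G `^ (1 - e)) * y <= Num.min Zc (w * y `^ e).
Proof.
move=> Zc0 zb0 /andP[e0 e1] G0 /andP[y0 yG] zw.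
have e1' : 0 <= 1 - e by rewrite subr_ge0.
have Gp : 0 < G `^ (1 - e) by rewrite powR_gt0.
rewrite le_min; apply/andP; split.
  apply: (@le_trans _ _ (Zc / G * y)).
    by rewrite ler_wpM2r ?(ltW y0) // ge_min lexx.
  by rewrite -mulrA ler_piMr ?(ltW Zc0) // mulrC ler_pdivrMr // mul1r.
apply: (@le_trans _ _ (zbar / G `^ (1 - e) * y)).
  by rewrite ler_wpM2r ?(ltW y0) // ge_min lexx orbT.
apply: (@le_trans _ _ (zbar * y `^ e)); last by rewrite ler_wpM2r ?powR_ge0.
rewrite -mulrA ler_pM2l // mulrC ler_pdivrMr //.
have {1}-> : y = y `^ e * y `^ (1 - e).
  by rewrite -powRD ?(gt_eqF y0) ?implybT // addrC subrK powRr1 // ltW.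
rewrite ler_wpM2l ?powR_ge0 // ge0_ler_powR // ?nnegrE ltW //.
Qed.

(** The bound is the smaller of [c^2 mu y^2] and [c^3 nu y^2], obtained from
    the two alternatives. *)
Lemma sufficient_progress_decrease (c mu zt y st D m0 y0 : R) : 0 < c <= 1 ->
  0 < m0 -> 0 < y0 <= y -> m0 <= mu -> m0 <= zt ->
  sufficient_progress c mu zt y st D -> c ^+ 3 * m0 * y0 ^+ 2 <= D.
Proof.
move=> /andP[c0 c1] m00 /andP[y00 yy] mmu mzt.
have y0' : 0 <= y by rewrite (le_trans (ltW y00)).
have yy2 : y0 ^+ 2 <= y ^+ 2 by rewrite ler_pXn2r ?nnegrE ?(ltW y00).
have c0' := ltW c0.
have base nu : m0 <= nu -> c ^+ 3 * m0 * y0 ^+ 2 <= c ^+ 3 * nu * y ^+ 2.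
  move=> mnu; apply: ler_pM => //; rewrite ?mulr_ge0 ?exprn_ge0 ?(ltW m00) ?(ltW y00) //.
  by rewrite ler_wpM2l ?exprn_ge0.
have cy0 : 0 <= c * y by rewrite mulr_ge0.
case=> [[D1 st1]|[nu nuE [D1 st1]]].
  apply: le_trans (base _ mmu) _; apply: le_trans D1.
  have h := ler_wpM2l cy0 st1; apply: le_trans h.
  have -> : c * y * (c * mu * y) = c ^+ 2 * (mu * y ^+ 2) by ring.
  rewrite -mulrA ler_wpM2r //.
    by rewrite mulr_ge0 ?sqr_ge0 // (le_trans (ltW m00)).
  by rewrite exprS ler_piMl // exprn_ge0.
have mnu : m0 <= nu by case: nuE => ->.
apply: le_trans (base _ mnu) _; apply: le_trans D1.
have nu0 : 0 <= nu by rewrite (le_trans (ltW m00)).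
have st0 : 0 <= st by apply: le_trans st1.
have : (c * y) ^+ 2 <= st ^+ 2 by rewrite ler_pXn2r ?nnegrE.
move=> /(ler_wpM2l (mulr_ge0 c0' nu0)); apply: le_trans.
by rewrite le_eqVlt; apply/orP; left; apply/eqP; ring.
Qed.

(** [De] stands for a decrease of the desingularized objective, for which the
    Kurdyka-Lojasiewicz inequality gives [D <= y De]. *)
Lemma sufficient_progress_step (c mu zt y st D De N N' w w' e e' : R) :
  0 < c <= 1 -> 0 < N -> 0 < N' -> 0 < w -> 0 < w' -> 0 < e <= 1 -> 0 < e' <= 1 ->
  0 < y -> 0 <= De -> D <= y * De ->
  mu = Num.min N (w * y `^ e) -> zt = Num.min N' (w' * y `^ e') ->
  sufficient_progress c mu zt y st D ->
  st <= (c ^- 2 + (c ^+ 2 * N)^-1 + (c ^- 2 + (c ^+ 2 * N')^-1))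
    * (De + w `^ (- (1 / e)) + w' `^ (- (1 / e'))).
Proof.
move=> c01 N0 N'0 w0 w'0 e01 e'01 y0 De0 DDe muE ztE.
have /andP[c0 c1] := c01.
set k := c ^- 2 + (c ^+ 2 * N)^-1; set k' := c ^- 2 + (c ^+ 2 * N')^-1.
set om := w `^ _; set om' := w' `^ _.
have om0 : 0 <= om by exact: powR_ge0.
have om'0 : 0 <= om' by exact: powR_ge0.
have ik : 0 < (c ^+ 2 * N)^-1 by rewrite invr_gt0 mulr_gt0 // exprn_gt0.
have ik' : 0 < (c ^+ 2 * N')^-1 by rewrite invr_gt0 mulr_gt0 // exprn_gt0.
have ic : 0 < c ^- 2 by rewrite invr_gt0 exprn_gt0.
have k0 : 0 <= k by rewrite addr_ge0 // ltW.
have k'0 : 0 <= k' by rewrite addr_ge0 // ltW.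
have le1 : k * (De + om) <= (k + k') * (De + om + om').
  by apply: ler_pM; rewrite ?lerDl // addr_ge0.
have le2 : k' * (De + om') <= (k + k') * (De + om + om').
  have h1 : k' <= k + k' by rewrite lerDr.
  have h2 : De + om' <= De + om + om' by rewrite addrAC lerDl.
  by apply: ler_pM => //; rewrite addr_ge0.
case=> [[D1 _]|[nu nuE [D1 st1]]].
  apply: le_trans le1; apply: (@le_trans _ _ (c ^- 2 * De)); last first.
    by apply: ler_pM; rewrite ?lerDl ?(ltW ic) ?(ltW ik).
  have : c * st <= De.
    by rewrite -(ler_pM2l y0); move: (le_trans D1 DDe); lra.
  rewrite -ler_pdivlMl // => h; apply: le_trans h _.
  by rewrite ler_wpM2r // lef_pV2 ?posrE ?exprn_gt0 // expr2 ler_piMr // ltW.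
case: nuE => nuE.
  apply: le_trans le1; apply: (weighted_step_le (nu := nu) c01 N0 w0 e01 y0 De0) => //.
    by rewrite nuE.
  exact: le_trans D1 DDe.
apply: le_trans le2; apply: (weighted_step_le (nu := nu) c01 N'0 w'0 e'01 y0 De0) => //.
  by rewrite nuE.
exact: le_trans D1 DDe.
Qed.

End ProgressConsequences.

Theorem theorem3p9 (R : realType) (n : nat) (f : 'cV[R]_n -> R)
  (rho sigma alpha Acap s abar Zcap zexp zbar : R)
  (theta a zeta z : nat -> R) (B : nat -> 'M[R]_n)
  (x : nat -> 'cV[R]_n) (VH : set 'cV[R]_n) (xs : 'cV[R]_n)
  (f_C2 : twice_continuously_differentiable f)
  (rho01 : 0 < rho < 1) (sigma01 : 0 < sigma < 1)
  (alpha01 : 0 < alpha <= 1) (Acap01 : 0 < Acap <= 1) (s_gt0 : 0 < s)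
  (theta_ge0 : forall k, 0 <= theta k)
  (abar_gt0 : 0 < abar) (a_ge : forall k, abar <= a k)
  (zeta_ge0 : forall k, 0 <= zeta k)
  (x_gen : generated f rho sigma alpha Acap s theta a zeta B x)
  (VH_nbhs : accumulation_points x `<=` VH^°)
  (hess_lip : locally_lipschitz_on VH (hess f))
  (B_hess : forall k, B k = hess f (x k))
  (Zcap_gt0 : 0 < Zcap) (zexp01 : 0 < zexp <= 1)
  (zbar_gt0 : 0 < zbar) (z_ge : forall k, zbar <= z k)
  (zeta_def : forall k,
     zeta k = Num.min Zcap (z k * enorm (grad f (x k)) `^ zexp))
  (a_sum : (\sum_(1 <= k <oo) (a k `^ (- (1 / alpha)))%:E < +oo)%E)
  (z_sum : (\sum_(1 <= k <oo) (z k `^ (- (1 / zexp)))%:E < +oo)%E)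
  (xs_acc : accumulation_points x xs)
  (f_KL : KL_property f xs) :
  (exists K : nat, stops_at f x K) \/
  (x k @[k --> \oo] --> xs /\
   enorm (grad f (x k)) @[k --> \oo] --> (0 : R)).
Proof.
have [[K0 gK0]|never] := pselect (exists K, grad f (x K) = 0).
  left; have ex : exists K, grad f (x K) == 0 by exists K0; exact/eqP.
  case: (ex_minnP ex) => K /eqP gK Kmin; exists K; split=> // k kK /eqP /Kmin.
  by rewrite leqNgt kK.
right; have gn0 k : grad f (x k) != 0 by apply/eqP => gk; apply: never; exists k.
have a_gt0 k : 0 < a k by apply: lt_le_trans (a_ge k).
have z_gt0 k : 0 < z k by apply: lt_le_trans (z_ge k).
have /andP[A0 A1] := Acap01; have /andP[al0 al1] := alpha01.
have H_sym k : (hess f (x k))^T = hess f (x k) by have [] := x_gen k; rewrite B_hess.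
have iter k : iteration f rho sigma alpha Acap s (theta k) (a k) (zeta k)
    (hess f (x k)) (x k) (x k.+1).
  by have [_ [_]] := x_gen k; rewrite B_hess; apply; exact/eqP.
have acc := accumulation_pointsP xs_acc.
have fcont : continuous f.
  by move=> y; apply: differentiable_continuous; case: f_C2.
have gcont : continuous (grad f).
  by move=> y; apply: differentiable_continuous; case: f_C2.
(* strict descent keeps the values above [f xs], where the
   Kurdyka-Lojasiewicz inequality applies *)
have desc k : f (x k.+1) < f (x k).
  exact: iteration_descent rho01 sigma01 s_gt0 (theta_ge0 k) (zeta_ge0 k)
    (H_sym k) (gn0 k) (iter k).
have mono i j : (i <= j)%N -> f (x j) <= f (x i).
  move=> /subnK <-; elim: (j - i)%N => // m IH.
  by rewrite addSn; exact: le_trans (ltW (desc _)) IH.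
have near_f eps : 0 < eps -> exists2 r : R, 0 < r &
    forall y, enorm (y - xs) < r -> `|f xs - f y| < eps.
  move=> eps0; apply/nbhs_enormP.
  by have /cvgrPdist_lt := fcont xs; apply.
have above k : 0 < f (x k) - f xs.
  rewrite subr_gt0 ltNge; apply/negP => fk.
  have gap : 0 < f xs - f (x k.+1) by rewrite subr_gt0; exact: lt_le_trans (desc k) fk.
  have [r r0 nr] := near_f _ gap; have [j kj jr] := acc r k.+1 r0.
  have := nr _ jr; have := mono _ _ kj => h; rewrite ger0_norm; last by lra.
  lra.
have to_fs eps : 0 < eps -> exists N, forall k, (N <= k)%N -> f (x k) - f xs < eps.
  move=> eps0; have [r r0 nr] := near_f _ eps0; have [N _ Nr] := acc r 0%N r0.
  exists N => k Nk; have := mono _ _ Nk; have := nr _ Nr.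
  by rewrite distrC gtr0_norm ?above //; lra.
have [eta [V [phi [eta0 Vxs des KL]]]] := f_KL.
have [r [M [L [G [[r0 M1 L0 G0] loc]]]]] :=
  local_bounds f_C2 (VH_nbhs _ xs_acc) hess_lip Vxs.
pose cz := Num.min (Zcap / G) (zbar / G `^ (1 - zexp)).
have cz0 : 0 < cz by rewrite lt_min !divr_gt0 ?powR_gt0.
have [c0 c00 prog0] := step_progress f_C2 r0 M1 L0 G0 (ltW Zcap_gt0) cz0
  (fun y u h => let: And4 _ _ hu _ := loc y h in hu u)
  (fun y y' u h h' => let: And4 _ _ _ hl := loc y h in hl y' u h')
  (fun y h => let: And4 _ hg _ _ := loc y h in hg)
  alpha rho01 sigma01 s_gt0 Acap01.
pose c := Num.min c0 1.
have c01 : 0 < c <= 1 by rewrite /c lt_min c00 ltr01 ge_min lexx orbT.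
pose y k := enorm (grad f (x k)).
have y0 k : 0 < y k by exact: enorm_gt0.
pose mu k := Num.min Acap (a k * y k `^ alpha).
have prog k : enorm (x k - xs) < r / 2 ->
    sufficient_progress c (mu k) (zeta k) (y k) (enorm (x k.+1 - x k))
      (f (x k) - f (x k.+1)).
  move=> xr; have xr' : enorm (x k - xs) < r by lra.
  apply: (@sufficient_progress_le _ c0) => //; rewrite ?enorm_ge0 //.
  - by rewrite /c ge_min lexx.
  - by rewrite /mu le_min (ltW A0) mulr_ge0 ?powR_ge0 // ltW.
  apply: prog0 (iter k) => //; first by rewrite zeta_def ge_min lexx.
  rewrite zeta_def; apply: regularization_ge => //.
  by rewrite y0 /=; have [] := loc _ xr'.
have r20 : 0 < r / 2 by rewrite divr_gt0.
(* at a nonstationary point the decrease would be bounded below along a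
   subsequence, while the values converge *)
have stat : grad f xs = 0.
  apply/eqP; apply: contraT => gxs.
  pose y1 := `|grad f xs| / 2.
  have y10 : 0 < y1 by rewrite divr_gt0 // normr_gt0.
  have : nbhs xs [set v | `|grad f xs - grad f v| < y1].
    by have /cvgrPdist_lt := gcont xs; apply.
  move=> /nbhs_enormP[r1 r10 nr1].
  pose m0 := Num.min (Num.min Acap (abar * y1 `^ alpha))
    (Num.min Zcap (zbar * y1 `^ zexp)).
  have m00 : 0 < m0 by rewrite !lt_min A0 Zcap_gt0 !mulr_gt0 ?powR_gt0.
  have /andP[cp _] := c01.
  have del0 : 0 < c ^+ 3 * m0 * y1 ^+ 2.
    exact: mulr_gt0 (mulr_gt0 (exprn_gt0 _ cp) m00) (exprn_gt0 _ y10).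
  have [N HN] := to_fs _ del0.
  have rr : 0 < Num.min r1 (r / 2) by rewrite lt_min r10.
  have [k Nk] := acc _ N rr; rewrite lt_min => /andP[kr1 kr].
  have yk : y1 <= y k.
    apply: le_trans (norm_le_enorm _).
    have := nr1 _ kr1 => /= h.
    have := ler_normD (grad f xs - grad f (x k)) (grad f (x k)).
    by rewrite subrK; rewrite /y1 in h *; lra.
  have pw (e : R) : 0 < e -> y1 `^ e <= y k `^ e.
    by move=> e0; rewrite ge0_ler_powR // ?nnegrE ltW.
  have mmu : m0 <= mu k.
    rewrite /mu le_min; apply/andP; split; first by rewrite /m0 !ge_min lexx.
    apply: (@le_trans _ _ (abar * y1 `^ alpha)); first by rewrite /m0 !ge_min lexx !orbT.
    by rewrite ler_pM ?powR_ge0 ?pw // ltW.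
  have mz : m0 <= zeta k.
    rewrite zeta_def le_min; apply/andP; split; first by rewrite /m0 !ge_min lexx !orbT.
    apply: (@le_trans _ _ (zbar * y1 `^ zexp)); first by rewrite /m0 !ge_min lexx !orbT.
    have /andP[ze0 _] := zexp01.
    by rewrite ler_pM ?powR_ge0 ?pw // ltW.
  have y1k : 0 < y1 <= y k by rewrite y10.
  have := sufficient_progress_decrease c01 m00 y1k mmu mz (prog _ kr).
  have := HN _ Nk; have := above k.+1; lra.
have [e0 e00 e0eta] : exists2 e0 : R, 0 < e0 & (e0%:E <= eta)%E.
  case: eta eta0 {des KL} => [e||] // e0; first by exists e; rewrite // -lte_fin.
  by exists 1 => //; rewrite leey.
have [k1 Hk1] := to_fs _ e00.
have ltu k : (k1 <= k)%N -> ((f (x k) - f xs)%:E < eta)%E.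
  by move=> kk; apply: lt_le_trans e0eta; rewrite lte_fin Hk1.
have [EA [EA0 EAE EAc]] := summable_tails (fun k => powR_ge0 _ _) a_sum.
have [EZ [EZ0 EZE EZc]] := summable_tails (fun k => powR_ge0 _ _) z_sum.
pose Phi k := phi (f (x k) - f xs).
have [[phi_cont phi_ge0] _ _ phi00 phi'0] := des.
have Phi0 k : (k1 <= k)%N -> 0 <= Phi k.
  by move=> kk; apply: phi_ge0; split; [exact/ltW/above | exact: ltu].
pose K := c ^- 2 + (c ^+ 2 * Acap)^-1 + (c ^- 2 + (c ^+ 2 * Zcap)^-1).
have /andP[cp _] := c01.
have K0 : 0 < K by rewrite !addr_gt0 ?invr_gt0 ?mulr_gt0 ?exprn_gt0.
(* the potential adds to the desingularized values the tails of both series *)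
pose Psi k := K * (Phi k + EA k + EZ k).
have step k : (k1 <= k)%N -> enorm (x k - xs) < r / 2 ->
    enorm (x k.+1 - x k) <= Psi k - Psi k.+1.
  move=> kk xr; have xr' : enorm (x k - xs) < r by lra.
  have kk1 : (k1 <= k.+1)%N by rewrite leqW.
  have cg := concave_gradient_le des (ltW (above k.+1)) (above k) (ltu _ kk1) (ltu _ kk).
  have [Vk _ _ _] := loc _ xr'; have kl := KL _ Vk (above k) (ltu _ kk).
  have d0 := phi'0 _ (above k) (ltu _ kk).
  set d := derive1 phi _ in cg kl d0.
  have D0 : 0 < f (x k) - f (x k.+1) by rewrite subr_gt0 desc.
  have cg' : d * (f (x k) - f (x k.+1)) <= Phi k - Phi k.+1.
    by move: cg; rewrite /Phi; lra.
  have De0 : 0 <= Phi k - Phi k.+1.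
    by apply: le_trans cg'; rewrite mulr_ge0 // ltW.
  have DDe : f (x k) - f (x k.+1) <= y k * (Phi k - Phi k.+1).
    have := ler_wpM2l (ltW (y0 k)) cg'; have := ler_wpM2r (ltW D0) kl.
    rewrite -/(y k); lra.
  have := sufficient_progress_step c01 A0 Zcap_gt0 (a_gt0 k) (z_gt0 k) alpha01 zexp01
    (y0 k) De0 DDe erefl (zeta_def k) (prog _ xr).
  rewrite -/K EAE EZE /Psi; lra.
have Psi0 k : (k1 <= k)%N -> 0 <= Psi k.
  by move=> kk; rewrite mulr_ge0 ?(ltW K0) // !addr_ge0 ?Phi0.
have Phic eps : 0 < eps -> exists N, forall k, (N <= k)%N -> Phi k < eps.
  move=> eps0; have [del del0 Hdel] := desingularizing_near0 des eta0 eps0.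
  have [N HN] := to_fs _ del0; exists (maxn N k1) => k.
  rewrite geq_max => /andP[Nk kk].
  by apply: Hdel; [exact/ltW/above | exact: ltu | exact: HN].
have Psic eps : 0 < eps -> exists N, forall k, (N <= k)%N -> Psi k < eps.
  move=> eps0; have e3 : 0 < eps / K / 3 by rewrite !divr_gt0.
  have [N1 H1] := Phic _ e3; have [N2 H2] := EAc _ e3; have [N3 H3] := EZc _ e3.
  exists (maxn N1 (maxn N2 N3)) => k; rewrite !geq_max => /andP[k1' /andP[k2 k3]].
  have := H1 _ k1'; have := H2 _ k2; have := H3 _ k3.
  rewrite /Psi -ltr_pdivlMl // mulrC; lra.
have xc := potential_convergence r20 acc Psi0 Psic step.
have xlim : x k @[k --> \oo] --> xs.
  apply/cvgrPdist_lt => eps eps0; have [N HN] := xc _ eps0.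
  exists N => //= k Nk; rewrite distrC.
  by apply: le_lt_trans (norm_le_enorm _) (HN _ Nk).
split=> //; have glim : grad f (x k) @[k --> \oo] --> (0 : 'cV[R]_n).
  by rewrite -stat; apply: continuous_cvg => //; exact: gcont.
apply/cvgrPdist_lt => eps eps0.
have e1 : 0 < eps / n.+1%:R by rewrite divr_gt0.
have /cvgrPdist_lt /(_ _ e1) [N _ HN] := glim.
exists N => //= k Nk; rewrite sub0r normrN ger0_norm ?enorm_ge0 //.
apply: le_lt_trans (enorm_le_norm _) _.
by rewrite mulrC -ltr_pdivlMr //; have := HN k Nk; rewrite /= sub0r normrN.
Qed.
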